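(* Let $A=\oplus_{n\geq 0}A_n$ be a split basic locally finite dimensional positively $\mathbb Z$-graded algebra with enough idempotents such that $A_0$ is semisimple. Then there exists a $\mathbb Z$-graded quiver $Q$ with $\deg(a)>0$ for all $a\in Q_1$, uniquely determined up to isomorphism of $\mathbb Z$-graded quivers, such that $A$ is isomorphic to $KQ/I$ for a homogeneous ideal $I$ of $KQ$ with $I\subseteq KQ_{\geq 2}$. If, moreover, $A$ is connected and the equality $A_n=A_1\cdot\stackrel{n}{\ldots}\cdot A_1$ holds for all $n>0$, then the following assertions are equivalent: 1. $A$ is graded pseudo-Frobenius. 2. There exists a graded Nakayama form $(-,-):A\times A\longrightarrow K$ with constant degree map. In particular, the Nakayama automorphism $\eta$ is always graded in this latter case.
   Context: $K$ is a fixed field; the grading group is $H=\mathbb Z$. Algebras are associative $K$-algebras, not necessarily unital. A *graded algebra with enough idempotents* is a graded algebra $A=\oplus_{h\in H}A_h$ having a family $(e_i)_{i\in I}$ of nonzero orthogonal idempotents, homogeneous of degree $0$, with $\oplus_{i\in I}e_iA=A=\oplus_{i\in I}Ae_i$ (a *distinguished family* ). $A$ is *locally finite dimensional* if $\dim_K e_iA_he_j<\infty$ for all $i,j\in I$, $h\in H$. The graded Jacobson radical $J^{gr}(A)$ is the intersection of all maximal graded left ideals of $A$ (equivalently, of all maximal graded right ideals). A locally finite dimensional graded algebra with enough idempotents is *weakly basic* if it has a distinguished family $(e_i)_{i\in I}$ such that each $e_iA_0e_i$ is local and $e_iAe_j\subseteq J^{gr}(A)$ for all $i\neq j$; it is *basic*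 if in addition $e_iA_he_i\subseteq J^{gr}(A)$ for all $i\in I$, $h\neq0$. It is *split* if $e_iA_0e_i/e_iJ(A_0)e_i\cong K$ for each $i$, $J(A_0)$ being the Jacobson radical of $A_0$. $A$ is *connected* if for each $(i,j)\in I\times I$ there is a sequence $i=i_0,i_1,\dots,i_n=j$ in $I$ such that for each $k=1,\dots,n$ either $e_{i_{k-1}}Ae_{i_k}\neq0$ or $e_{i_k}Ae_{i_{k-1}}\neq0$. An $H$-graded quiver is a quiver $Q$ (vertices $Q_0$, arrows $Q_1$) with a map $\deg:Q_1\to H$; it induces an $H$-grading on the path algebra $KQ$ (vertices $e_i$ of degree $0$, the degree of a path being the sum of degrees of its arrows). $KQ_{\geq n}$ is the span of paths of length $\geq n$. For graded $K$-vector spaces $V,W$ with finite dimensional homogeneous components, put $D(V)=\oplus_h\mathrm{Hom}_K(V_h,K)$. A bilinear form $V\times W\to K$ is *of degree $d\in H$* if $(V_h,W_k)\neq 0$ implies $h+k=d$; such a form is *nondegenerate* if the induced maps $W\to D(V)$ and $V\to D(W)$ are bijective. A *graded Nakayama form* for a weakly basic $A$ is a bilinear form $(-,-):A\times A\to K$ such that: (i) $(ab,c)=(a,bc)$ for all $a,b,c\in A$; (ii) for each $i\in I$ there is a unique $\nu(i)\in I$ with $(e_iA,Ae_{\nu(i)})\neq 0$, and $\nu:I\to I$ is a bijection; (iii) there is a map $\mathbf h:I\to H$ (the *degree map* ) such that, for all $i,j\in I$, the induced form $e_iAe_j\times e_jAe_{\nu(i)}\to K$ is a nondegenerate graded bilinear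 form of degree $\mathbf h(i)$. A graded algebra is *graded pseudo-Frobenius* if it is weakly basic and admits a graded Nakayama form. The *Nakayama automorphism* associated to a graded Nakayama form $(-,-)$ is the automorphism $\eta$ of the (ungraded) algebra $A$ determined by $(a,-)=(-,\eta(a))$ for all $a\in A$; it is *graded* if it preserves degrees. *)

(* Defs.v *)
From HB Require Import structures.
From mathcomp Require Import all_boot all_order all_algebra.
From mathcomp Require Import generic_quotient ring_quotient finmap monalg.
From mathcomp Require Import boolp classical_sets.

Set Implicit Arguments.
Unset Strict Implicit.
Unset Printing Implicit Defensive.

Import GRing.Theory.

Local Open Scope classical_set_scope.
Local Open Scope ring_scope.

Reserved Notation "x ** y" (at level 40, left associativity).

HB.mixin Record Lmodule_isNonUnitalAlgebra (K : fieldType) A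
    of GRing.Lmodule K A := {
  nmul : A -> A -> A;
  nmulA : associative nmul;
  nmulDl : left_distributive nmul +%R;
  nmulDr : right_distributive nmul +%R;
  nscaleAl : forall (k : K) (x y : A), k *: nmul x y = nmul (k *: x) y;
  nscaleAr : forall (k : K) (x y : A), k *: nmul x y = nmul x (k *: y)
}.

#[short(type="nualgType")]
HB.structure Definition NonUnitalAlgebra (K : fieldType) :=
  {A of GRing.Lmodule K A & Lmodule_isNonUnitalAlgebra K A}.

Notation "x ** y" := (nmul x y) : ring_scope.

Section NonUnitalTheory.
Context {K : fieldType} {A : nualgType K}.
Implicit Types x y : A.

Lemma nmul0l y : 0 ** y = 0.
Proof. by apply: (addIr (0 ** y)); rewrite -nmulDl !add0r. Qed.

Lemma nmul0r x : x ** 0 = 0.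
Proof. by apply: (addIr (x ** 0)); rewrite -nmulDr !add0r. Qed.

Lemma nmulNl x y : (- x) ** y = - (x ** y).
Proof. by apply: (addrI (x ** y)); rewrite -nmulDl !subrr nmul0l. Qed.

Lemma nmulNr x y : x ** (- y) = - (x ** y).
Proof. by apply: (addrI (x ** y)); rewrite -nmulDr !subrr nmul0r. Qed.

End NonUnitalTheory.

Section Subsets.
Context {K : fieldType} {A : nualgType K}.
Implicit Types S T V W L : set A.

Definition subspace V : Prop :=
  V 0 /\ forall (k : K) x y, V x -> V y -> V (k *: x + y).

Definition finite_sums S : set A :=
  [set x | exists2 s : seq A,
     (forall y, y \in s -> S y) & x = \sum_(y <- s) y].

(* For subspaces S and T this is the linear span of the products. *)
Definition product_space S T : set A :=
  finite_sums [set x | exists s t, [/\ S s, T t & x = s ** t]].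

Definition internal_direct_sum (I : eqType) (V : I -> set A) : Prop :=
  [/\ forall i, subspace (V i),
      forall x, exists s : seq I, exists2 f : I -> A,
        (forall i, V i (f i)) & x = \sum_(i <- s) f i
    & forall (s : seq I) (f : I -> A), uniq s -> (forall i, V i (f i)) ->
        \sum_(i <- s) f i = 0 -> forall i, i \in s -> f i = 0].

Definition finite_dimensional V : Prop :=
  exists s : seq A, forall x, V x ->
    exists c : nat -> K, x = \sum_(i < size s) c i *: s`_i.

Definition rideal_of (x : A) : set A := range (fun a : A => x ** a).
Definition lideal_of (x : A) : set A := range (fun a : A => a ** x).
Definition corner (x y : A) S : set A := [set x ** a ** y | a in S].

Definition is_grading (gr : int -> set A) : Prop :=
  internal_direct_sum gr /\
  forall g h x y, gr g x -> gr h y -> gr (g + h) (x ** y).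

Definition homogeneous_subset (gr : int -> set A) S : Prop :=
  forall x, S x -> exists s : seq int, exists2 f : int -> A,
    (forall h, gr h (f h) /\ S (f h)) & x = \sum_(h <- s) f h.

(* Here S plays the role of a subalgebra of A (A itself, A_0, e_i A_0 e_i)
   and L that of a left ideal of S. With enough idempotents, closure under
   scalars is automatic: if x = u ** x then k *: x = (k *: u) ** x. *)
Definition left_ideal S L : Prop :=
  [/\ L `<=` S, subspace L & forall s x, S s -> L x -> L (s ** x)].

Definition maximal_left_ideal S L : Prop :=
  [/\ left_ideal S L, L <> S
    & forall L', left_ideal S L' -> L `<=` L' -> L' = L \/ L' = S].

Definition minimal_left_ideal S L : Prop :=
  [/\ left_ideal S L, L <> [set 0]
    & forall L', left_ideal S L' -> L' `<=` L -> L' = [set 0] \/ L' = L].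

Definition jacobson_radical S : set A :=
  [set x | S x /\ forall L, maximal_left_ideal S L -> L x].

Definition local_algebra S : Prop :=
  exists M, maximal_left_ideal S M /\
    forall M', maximal_left_ideal S M' -> M' = M.

(* The regular left module is the sum of its simple submodules. *)
Definition semisimple_algebra S : Prop :=
  S `<=` finite_sums [set x | exists2 L, minimal_left_ideal S L & L x].

Definition graded_left_ideal (gr : int -> set A) L : Prop :=
  left_ideal setT L /\ homogeneous_subset gr L.

Definition maximal_graded_left_ideal (gr : int -> set A) L : Prop :=
  [/\ graded_left_ideal gr L, L <> setT
    & forall L', graded_left_ideal gr L' -> L `<=` L' -> L' = L \/ L' = setT].

Definition graded_jacobson_radical (gr : int -> set A) : set A :=
  [set x | forall L, maximal_graded_left_ideal gr L -> L x].

(* S/N is isomorphic to K as a K-algebra, the isomorphism being given by the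
   algebra map S -> K with kernel N that it induces. The values of f outside S
   are irrelevant. *)
Definition quotient_is_base_field S (N : set A) : Prop :=
  exists f : A -> K,
    [/\ forall (k : K) x y, S x -> S y -> f (k *: x + y) = k * f x + f y,
        forall x y, S x -> S y -> f (x ** y) = f x * f y,
        forall c : K, exists2 x, S x & f x = c
      & forall x, S x -> (f x = 0 <-> N x)].

Section Family.
Variables (gr : int -> set A) (I : choiceType) (e : I -> A).

Definition distinguished_family : Prop :=
  [/\ forall i, e i <> 0 /\ gr 0 (e i),
      forall i, e i ** e i = e i,
      forall i j, i != j -> e i ** e j = 0,
      internal_direct_sum (fun i => rideal_of (e i))
    & internal_direct_sum (fun i => lideal_of (e i))].

Definition locally_finite_dimensional : Prop :=
  forall i j h, finite_dimensional (corner (e i) (e j) (gr h)).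

Definition weakly_basic_family : Prop :=
  [/\ distinguished_family,
      locally_finite_dimensional,
      forall i, local_algebra (corner (e i) (e i) (gr 0))
    & forall i j, i != j ->
        corner (e i) (e j) setT `<=` graded_jacobson_radical gr].

Definition basic_family : Prop :=
  weakly_basic_family /\
  forall i h, h != 0 ->
    corner (e i) (e i) (gr h) `<=` graded_jacobson_radical gr.

Definition split_family : Prop :=
  forall i, quotient_is_base_field (corner (e i) (e i) (gr 0))
              (corner (e i) (e i) (jacobson_radical (gr 0))).

Definition linked (i j : I) : Prop :=
  corner (e i) (e j) setT <> [set 0] \/ corner (e j) (e i) setT <> [set 0].

Definition connected_family : Prop :=
  forall i j, exists2 s : seq I,
    path (fun k l => `[< linked k l >]) i s & last i s = j.

Definition bilinear_form (B : A -> A -> K) : Prop :=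
  (forall (k : K) x y z, B (k *: x + y) z = k * B x z + B y z) /\
  (forall (k : K) x y z, B z (k *: x + y) = k * B z x + B z y).

Definition pairs_nontrivially (B : A -> A -> K) V W : Prop :=
  exists v w, [/\ V v, W w & B v w != 0].

(* V and W are graded subspaces, with V_h = V `&` gr h. *)
Definition form_of_degree (B : A -> A -> K) V W (d : int) : Prop :=
  forall h k, pairs_nontrivially B (V `&` gr h) (W `&` gr k) -> h + k = d.

(* The restriction of f to V belongs to D(V), the direct sum of the duals of
   the V_h, i.e. f is linear on V and zero on almost all V_h. *)
Definition in_graded_dual V (f : A -> K) : Prop :=
  (forall (k : K) x y, V x -> V y -> f (k *: x + y) = k * f x + f y) /\
  (exists s : seq int, forall h, h \notin s ->
     forall x, V x -> gr h x -> f x = 0).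

(* V -> D(W) and W -> D(V) are bijective. *)
Definition nondegenerate_form (B : A -> A -> K) V W : Prop :=
  [/\ forall w, W w -> in_graded_dual V (B^~ w),
      forall v, V v -> in_graded_dual W (B v),
      forall f, in_graded_dual V f ->
        exists! w, W w /\ forall v, V v -> B v w = f v
    & forall f, in_graded_dual W f ->
        exists! v, V v /\ forall w, W w -> B v w = f w].

Definition nakayama_form_data (B : A -> A -> K) (nu : I -> I) (d : I -> int)
    : Prop :=
  [/\ bilinear_form B,
      forall a b c, B (a ** b) c = B a (b ** c),
      bijective nu,
      forall i j, pairs_nontrivially B (rideal_of (e i)) (lideal_of (e j)) <->
                  j = nu i
    & forall i j,
        let V := corner (e i) (e j) setT in
        let W := corner (e j) (e (nu i)) setT in
        form_of_degree B V W (d i) /\ nondegenerate_form B V W].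

Definition graded_nakayama_form (B : A -> A -> K) : Prop :=
  exists nu d, nakayama_form_data B nu d.

Definition nakayama_form_of_constant_degree (B : A -> A -> K) : Prop :=
  exists nu d, nakayama_form_data B nu d /\ exists d0, forall i, d i = d0.

End Family.

Definition graded_pseudo_Frobenius (gr : int -> set A) : Prop :=
  exists (I : choiceType) (e : I -> A),
    weakly_basic_family gr e /\ exists B, graded_nakayama_form gr e B.

End Subsets.

Definition algebra_iso (K : fieldType) (A B : nualgType K) (f : A -> B)
    : Prop :=
  [/\ linear f, {morph f : x y / x ** y} & bijective f].

Definition graded_algebra_iso (K : fieldType) (A B : nualgType K)
    (grA : int -> set A) (grB : int -> set B) : Prop :=
  exists2 f : A -> B, algebra_iso f & forall h x, grA h x -> grB h (f x).

Definition nakayama_automorphism (K : fieldType) (A : nualgType K)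
    (B : A -> A -> K) (eta : A -> A) : Prop :=
  algebra_iso eta /\ forall a b, B a b = B b (eta a).

Record ideal (K : fieldType) (A : nualgType K) := Ideal {
  ideal_set :> set A;
  ideal_subspace : subspace ideal_set;
  ideal_mull : forall a x, ideal_set x -> ideal_set (a ** x);
  ideal_mulr : forall a x, ideal_set x -> ideal_set (x ** a)
}.

Section QuotientAlgebra.
Variables (K : fieldType) (A : nualgType K) (J : ideal A).

Definition ideal_pred : A -> bool := fun x => `[< ideal_set J x >].

Lemma ideal_predP x : (x \in ideal_pred) <-> ideal_set J x.
Proof. by split => [/asboolP|/asboolP]. Qed.

Lemma ideal_pred_zmod_closed : zmod_closed ideal_pred.
Proof.
have [J0 JD] := ideal_subspace J.
split=> [|x y /ideal_predP Jx /ideal_predP Jy]; apply/ideal_predP => //.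
by rewrite addrC -scaleN1r; apply: JD.
Qed.

HB.instance Definition _ :=
  GRing.isZmodClosed.Build A ideal_pred ideal_pred_zmod_closed.

Local Open Scope quotient_scope.

Definition quotient_algebra := Quotient.quot (GRing.ZmodClosed.clone A ideal_pred _).

HB.instance Definition _ := GRing.Zmodule.on quotient_algebra.

Definition quotient_proj (x : A) : quotient_algebra := \pi_quotient_algebra x.

Lemma repK (u : quotient_algebra) : exists x, u = quotient_proj x.
Proof. by exists (repr u); rewrite /quotient_proj reprK. Qed.

Lemma projE x y : quotient_proj x = quotient_proj y <-> ideal_set J (x - y).
Proof.
rewrite -ideal_predP /quotient_proj.
by split => [/eqP|h]; [|apply/eqP]; rewrite -Quotient.idealrBE.
Qed.

Lemma projD x y :
  quotient_proj (x + y) = quotient_proj x + quotient_proj y.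
Proof. by rewrite /quotient_proj !piE. Qed.

Definition quotient_scale (k : K) (u : quotient_algebra) : quotient_algebra :=
  quotient_proj (k *: repr u).

Definition quotient_mul (u v : quotient_algebra) : quotient_algebra :=
  quotient_proj (repr u ** repr v).

Lemma reprB x : ideal_set J (repr (quotient_proj x) - x).
Proof. by apply/projE; rewrite /quotient_proj reprK. Qed.

Lemma Jscale k x : ideal_set J x -> ideal_set J (k *: x).
Proof.
move=> Jx; rewrite -[_ *: _]addr0.
by have [J0 JD] := ideal_subspace J; apply: JD.
Qed.

Lemma Jadd x y : ideal_set J x -> ideal_set J y -> ideal_set J (x + y).
Proof.
by move=> Jx Jy; rewrite -[x]scale1r; have [_ JD] := ideal_subspace J; apply: JD.
Qed.

Lemma projZ k x : quotient_proj (k *: x) = quotient_scale k (quotient_proj x).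
Proof.
apply/esym/projE.
by rewrite -scalerBr; apply: Jscale; apply: reprB.
Qed.

Lemma projM x y :
  quotient_proj (x ** y) = quotient_mul (quotient_proj x) (quotient_proj y).
Proof.
apply/esym/projE.
set x' := repr _; set y' := repr _.
have -> : x' ** y' - x ** y = (x' - x) ** y' + x ** (y' - y).
  by rewrite nmulDl nmulDr nmulNl nmulNr addrA subrK.
by apply: Jadd; [apply: ideal_mulr | apply: ideal_mull]; apply: reprB.
Qed.

Lemma scaleqA a b u :
  quotient_scale a (quotient_scale b u) = quotient_scale (a * b) u.
Proof. by have [x ->] := repK u; rewrite -!projZ scalerA. Qed.

Lemma scaleq1 : left_id 1 quotient_scale.
Proof. by move=> u; have [x ->] := repK u; rewrite -projZ scale1r. Qed.

Lemma scaleqDr : right_distributive quotient_scale +%R.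
Proof.
move=> k u v; have [[x ->] [y ->]] := (repK u, repK v).
by rewrite -projD -!projZ scalerDr projD.
Qed.

Lemma scaleqDl u : {morph quotient_scale^~ u : a b / a + b}.
Proof. by move=> a b; have [x ->] := repK u; rewrite -!projZ scalerDl projD. Qed.

HB.instance Definition _ := GRing.Zmodule_isLmodule.Build K quotient_algebra
  scaleqA scaleq1 scaleqDr scaleqDl.

Lemma mulqA : associative quotient_mul.
Proof.
move=> u v w; have [[[x ->] [y ->]] [z ->]] := (repK u, repK v, repK w).
by rewrite -!projM nmulA.
Qed.

Lemma mulqDl : left_distributive quotient_mul +%R.
Proof.
move=> u v w; have [[[x ->] [y ->]] [z ->]] := (repK u, repK v, repK w).
by rewrite -projD -!projM nmulDl projD.
Qed.

Lemma mulqDr : right_distributive quotient_mul +%R.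
Proof.
move=> u v w; have [[[x ->] [y ->]] [z ->]] := (repK u, repK v, repK w).
by rewrite -projD -!projM nmulDr projD.
Qed.

Lemma scaleqAl (k : K) (u v : quotient_algebra) :
  k *: quotient_mul u v = quotient_mul (k *: u) v.
Proof.
have [[x ->] [y ->]] := (repK u, repK v).
by rewrite -projM -[LHS]projZ -[k *: quotient_proj x]projZ -projM nscaleAl.
Qed.

Lemma scaleqAr (k : K) (u v : quotient_algebra) :
  k *: quotient_mul u v = quotient_mul u (k *: v).
Proof.
have [[x ->] [y ->]] := (repK u, repK v).
by rewrite -projM -[LHS]projZ -[k *: quotient_proj y]projZ -projM nscaleAr.
Qed.

HB.instance Definition _ :=
  Lmodule_isNonUnitalAlgebra.Build K quotient_algebra
    mulqA mulqDl mulqDr scaleqAl scaleqAr.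

Definition quotient_grading (gr : int -> set A) (h : int)
    : set quotient_algebra :=
  [set quotient_proj x | x in gr h].

Lemma quotient_projE x y :
  quotient_proj x = quotient_proj y <-> ideal_set J (x - y).
Proof. exact: projE. Qed.

Lemma quotient_proj_surj (u : quotient_algebra) : exists x, quotient_proj x = u.
Proof. by have [x ->] := repK u; exists x. Qed.

Lemma quotient_proj_linear : linear quotient_proj.
Proof. by move=> k x y; rewrite projD projZ. Qed.

Lemma quotient_projM : {morph quotient_proj : x y / x ** y}.
Proof. by move=> x y; rewrite projM. Qed.

End QuotientAlgebra.

Arguments quotient_grading {K A} J gr h _.

Record gquiver := GQuiver {
  vertex : choiceType;
  arrow : choiceType;
  src : arrow -> vertex;
  tgt : arrow -> vertex;
  adeg : arrow -> int
}.

Definition gquiver_iso (Q Q' : gquiver) : Prop :=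
  exists (f0 : vertex Q -> vertex Q') (f1 : arrow Q -> arrow Q'),
    [/\ bijective f0, bijective f1,
        forall a, src (f1 a) = f0 (src a),
        forall a, tgt (f1 a) = f0 (tgt a)
      & forall a, adeg (f1 a) = adeg a].

Section PathAlgebra.
Variables (K : fieldType) (Q : gquiver).

Fixpoint is_walk (x : vertex Q) (s : seq (arrow Q)) : bool :=
  if s is a :: s' then (src a == x) && is_walk (tgt a) s' else true.

(* A path is its source vertex together with its successive arrows; the
   trivial path at x is (x, [::]). *)
Record qpath := QPath {
  qpath_val : vertex Q * seq (arrow Q);
  qpathP : is_walk qpath_val.1 qpath_val.2
}.

HB.instance Definition _ := [isSub for qpath_val].
HB.instance Definition _ := [Choice of qpath by <:].

Definition psource (p : qpath) : vertex Q := (qpath_val p).1.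
Definition parrows (p : qpath) : seq (arrow Q) := (qpath_val p).2.
Definition ptarget (p : qpath) : vertex Q :=
  last (psource p) (map (@tgt Q) (parrows p)).
Definition plength (p : qpath) : nat := size (parrows p).
Definition pdegree (p : qpath) : int := \sum_(a <- parrows p) adeg a.

Lemma pcat_subproof (p q : qpath) : ptarget p = psource q ->
  is_walk (psource p) (parrows p ++ parrows q).
Proof.
case: p q => [[x s] /= ws] [[y t] /= wt]; rewrite /ptarget /psource /parrows /=.
elim: s x ws => [x _ /= ->|a s IHs x /= /andP[-> ws]] //=.
exact: IHs.
Qed.

(* p followed by q, so that e_i (KQ) e_j is spanned by the paths from i to j. *)
Definition pcat (p q : qpath) : option qpath :=
  match ptarget p =P psource q with
  | ReflectT pq => Some (@QPath (psource p, parrows p ++ parrows q)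
                                (pcat_subproof pq))
  | ReflectF _ => None
  end.

Definition path_algebra := {malg K[qpath]}.

HB.instance Definition _ := GRing.Lmodule.on path_algebra.

Definition path_elt (p : option qpath) : path_algebra :=
  if p is Some r then << r >> else 0.

Definition path_mul (f g : path_algebra) : path_algebra :=
  \sum_(p <- msupp f) \sum_(q <- msupp g)
    (f@_p * g@_q) *: path_elt (pcat p q).

Local Open Scope fset_scope.

Lemma path_mulw (d1 d2 : {fset qpath}) (f g : path_algebra) :
  msupp f `<=` d1 -> msupp g `<=` d2 ->
  path_mul f g =
    \sum_(p <- d1) \sum_(q <- d2) (f@_p * g@_q) *: path_elt (pcat p q).
Proof.
move=> le1 le2; rewrite /path_mul (big_fset_incl _ le1) /=.
  apply/eq_bigr=> p _; apply/big_fset_incl => // q _ /mcoeff_outdom ->.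
  by rewrite mulr0 scale0r.
move=> p _ /mcoeff_outdom fp.
by rewrite big1 // => q _; rewrite fp mul0r scale0r.
Qed.

Lemma path_mulDl : left_distributive path_mul +%R.
Proof.
move=> f1 f2 g; set d := msupp f1 `|` msupp f2.
rewrite (@path_mulw d (msupp g) (f1 + f2)%R) ?msuppD_le ?fsubset_refl //.
rewrite (@path_mulw d (msupp g) f1) ?fsubsetUl ?fsubset_refl //.
rewrite (@path_mulw d (msupp g) f2) ?fsubsetUr ?fsubset_refl //.
rewrite -big_split /=; apply/eq_bigr=> p _.
rewrite -big_split /=; apply/eq_bigr=> q _.
by rewrite mcoeffD mulrDl scalerDl.
Qed.

Lemma path_mulDr : right_distributive path_mul +%R.
Proof.
move=> g f1 f2; set d := msupp f1 `|` msupp f2.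
rewrite (@path_mulw (msupp g) d g (f1 + f2)%R) ?msuppD_le ?fsubset_refl //.
rewrite (@path_mulw (msupp g) d g f1) ?fsubsetUl ?fsubset_refl //.
rewrite (@path_mulw (msupp g) d g f2) ?fsubsetUr ?fsubset_refl //.
rewrite -big_split /=; apply/eq_bigr=> p _.
rewrite -big_split /=; apply/eq_bigr=> q _.
by rewrite mcoeffD mulrDr scalerDl.
Qed.

Lemma path_scaleAl (k : K) (f g : path_algebra) :
  k *: path_mul f g = path_mul (k *: f) g.
Proof.
rewrite (@path_mulw (msupp f) (msupp g) (k *: f)) ?msuppZ_le ?fsubset_refl //.
rewrite scaler_sumr; apply/eq_bigr=> p _.
rewrite scaler_sumr; apply/eq_bigr=> q _.
by rewrite mcoeffZ scalerA mulrA.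
Qed.

Lemma path_scaleAr (k : K) (f g : path_algebra) :
  k *: path_mul f g = path_mul f (k *: g).
Proof.
rewrite (@path_mulw (msupp f) (msupp g) f (k *: g)) ?msuppZ_le ?fsubset_refl //.
rewrite scaler_sumr; apply/eq_bigr=> p _.
rewrite scaler_sumr; apply/eq_bigr=> q _.
by rewrite mcoeffZ scalerA mulrCA.
Qed.

Lemma path_mul0l g : path_mul 0 g = 0.
Proof. by rewrite /path_mul msupp0 big_seq_fset0. Qed.

Lemma path_mul0r g : path_mul g 0 = 0.
Proof. by rewrite /path_mul big1 // => p _; rewrite msupp0 big_seq_fset0. Qed.

Lemma path_mulU p q :
  path_mul (path_elt (Some p)) (path_elt (Some q)) = path_elt (pcat p q).
Proof.
rewrite (@path_mulw [fset p] [fset q]) ?msuppU_le //=.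
by rewrite !big_seq_fset1 !mcoeffUU mulr1 scale1r.
Qed.

Lemma path_algE (f : path_algebra) :
  f = \sum_(p <- msupp f) f@_p *: path_elt (Some p).
Proof.
rewrite {1}[f]monalgE; apply/eq_bigr=> p _; apply/malgP => q.
by rewrite mcoeffZ !mcoeffU mulr_natr.
Qed.

Lemma ptarget_pcat p q r : pcat p q = Some r ->
  [/\ psource r = psource p, ptarget r = ptarget q
    & parrows r = parrows p ++ parrows q].
Proof.
rewrite /pcat; case: eqP => // pq [<-]; split=> //.
rewrite /ptarget /parrows /psource /= map_cat last_cat.
by move: pq; rewrite /ptarget /parrows /psource => ->.
Qed.

Lemma pcatN p q : ptarget p <> psource q -> pcat p q = None.
Proof. by rewrite /pcat; case: eqP. Qed.

Lemma pcatS p q : ptarget p = psource q -> exists r, pcat p q = Some r.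
Proof. by rewrite /pcat; case: eqP => // pq _; eexists. Qed.

Lemma pcatA p q r :
  path_mul (path_elt (Some p)) (path_elt (pcat q r)) =
  path_mul (path_elt (pcat p q)) (path_elt (Some r)).
Proof.
have [pq|npq] := eqVneq (ptarget p) (psource q); last first.
  rewrite (pcatN (elimN eqP npq)) path_mul0l.
  have [qr|nqr] := eqVneq (ptarget q) (psource r); last first.
    by rewrite (pcatN (elimN eqP nqr)) path_mul0r.
  have [u qru] := pcatS qr; rewrite qru path_mulU pcatN //.
  by have [-> _ _] := ptarget_pcat qru; apply/eqP.
have [t pqt] := pcatS pq; rewrite pqt path_mulU.
have [t1 t2 t3] := ptarget_pcat pqt.
have [qr|nqr] := eqVneq (ptarget q) (psource r); last first.
  by rewrite (pcatN (elimN eqP nqr)) path_mul0r pcatN // t2; apply/eqP.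
have [u qru] := pcatS qr; rewrite qru path_mulU.
have [u1 u2 u3] := ptarget_pcat qru.
have [v pu] : exists v, pcat p u = Some v by apply: pcatS; rewrite u1.
have [w tr] : exists w, pcat t r = Some w by apply: pcatS; rewrite t2.
rewrite pu tr; congr path_elt; congr Some; apply: val_inj.
have [v1 _ v3] := ptarget_pcat pu; have [w1 _ w3] := ptarget_pcat tr.
have E (x : qpath) : qpath_val x = (psource x, parrows x).
  by rewrite /psource /parrows -surjective_pairing.
by rewrite /= !E v1 v3 w1 w3 u3 t1 t3 catA.
Qed.

Lemma path_ext (F G : path_algebra -> path_algebra) :
  linear F -> linear G ->
  (forall p, F (path_elt (Some p)) = G (path_elt (Some p))) -> F =1 G.
Proof.
move=> linF linG FG f.
have lin0 (H : path_algebra -> path_algebra) : linear H -> H 0%R = 0%R.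
  by move=> linH; have := linH (-1) 0%R 0%R; rewrite scaler0 addr0 scaleN1r addNr.
rewrite [f]path_algE; elim: (msupp f : seq _) => [|p s IHs].
  by rewrite big_nil !lin0.
by rewrite !big_cons linF linG FG IHs.
Qed.

Lemma path_mulA : associative path_mul.
Proof.
move=> f g h; move: f; apply: path_ext => [k x y|k x y|p] /=.
1,2: by rewrite !path_mulDl -!path_scaleAl.
move: g; apply: path_ext => [k x y|k x y|q] /=.
1,2: by rewrite ?(path_mulDl, path_mulDr) -?(path_scaleAl, path_scaleAr).
move: h; apply: path_ext => [k x y|k x y|r] /=.
1,2: by rewrite !path_mulDr -!path_scaleAr.
by rewrite !path_mulU pcatA.
Qed.

HB.instance Definition _ := Lmodule_isNonUnitalAlgebra.Build K path_algebra
  path_mulA path_mulDl path_mulDr path_scaleAl path_scaleAr.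

Lemma path_algebra_mulE (f g : path_algebra) :
  f ** g = \sum_(p <- msupp f) \sum_(q <- msupp g)
             (f@_p * g@_q) *: path_elt (pcat p q).
Proof. by []. Qed.

Definition path_grading (h : int) : set path_algebra :=
  [set f | forall p, p \in msupp f -> pdegree p = h].

Definition paths_of_length_ge (n : nat) : set path_algebra :=
  [set f | forall p, p \in msupp f -> (n <= plength p)%N].

End PathAlgebra.

Arguments path_grading K Q h _ : clear implicits.
Arguments paths_of_length_ge K Q n _ : clear implicits.

Definition presented_by (K : fieldType) (A : nualgType K)
    (gr : int -> set A) (Q : gquiver) : Prop :=
  (forall a : arrow Q, 0 < adeg a) /\
  exists J : ideal (path_algebra K Q),
    [/\ homogeneous_subset (path_grading K Q) J,
        ideal_set J `<=` paths_of_length_ge K Q 2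
      & graded_algebra_iso gr (quotient_grading J (path_grading K Q))].

(* Main.v *)
Require Import Defs.
From mathcomp Require Import all_boot all_order all_algebra.
From mathcomp Require Import finmap monalg.
From mathcomp Require Import boolp classical_sets zify.

Set Implicit Arguments.
Unset Strict Implicit.
Unset Printing Implicit Defensive.

Import Order.TTheory GRing.Theory Num.Theory.

Local Open Scope classical_set_scope.
Local Open Scope ring_scope.

(** The degree-zero part of [A] is semisimple and split, its radical vanishes,
    and a maximal left ideal [L] of [A_0] extends to the maximal graded left
    ideal [L + A_{>0}] of [A]. Hence the elements of degree zero in the graded
    radical are zero, and the basic and split hypotheses leave only
    [e_i A_0 e_j = 0] for [i != j] and [e_i A_0 e_i = K e_i]
    ([degree0_mull]): [A_0] is a direct sum of copies of [K], indexed by [I].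

    Quiver. Call an element of degree [h] decomposable if it is a sum of
    products of elements of positive degree. The quiver has vertex set [I], and
    its arrows from [i] to [j] of degree [h > 0] are a basis of [e_i A_h e_j]
    modulo decomposables, which is finite by local finiteness
    ([exists_arrow_coordinates]). The induced map from the path algebra is onto
    by induction on the degree ([canonical_map_surj_nat]), and its kernel
    involves only paths of length at least two: each vertex and each arrow has a
    linear functional on [A] that is 1 on its value and 0 on the values of all
    other paths ([canonical_map_kernel]).
    Conversely, in any presentation [KQ -> A] the vertices of [Q] become
    primitive orthogonal idempotents spanning [A_0], so they are the [e_i]
    ([exists_vertex_bijection]); and since the kernel lies in length at least
    two, the arrows from one vertex to another of degree [h] become a basis
    modulo decomposables, so that their number is determined by [A]
    ([arrow_enumeration]).

    Nakayama forms. Nondegeneracy yields, for each [a], a unique [eta a] with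
    [(a, -) = (-, eta a)] ([exists_nakayama_automorphism]). Applied twice, it
    also shows that [e_i A_h e_j] is nonzero exactly when
    [e_(nu i) A_(h + d j - d i) e_(nu j)] is ([nonzero_corner_nu]). Take
    [h = 1]: the second degree is nonnegative, and it cannot be zero as that
    would force [i = j]; so [d i <= d j] whenever there is an arrow from [i] to
    [j]. Symmetrically [d j <= d i] whenever there is an arrow from [nu i] to
    [nu j]. As [A] is generated in degree one, a nonzero [e_i A_h e_j] with
    [h > 0] is reached by a chain of arrows, and so is its partner under [nu];
    the two inequalities then give [d i = d j]. Connectedness makes [d]
    constant ([connected_constant_degree]), which in turn makes [eta] graded.
    Finally, pseudo-Frobenius algebras are defined by an arbitrary weakly basic
    family, but [A_0] leaves no freedom: such a family is a reindexing of
    [(e_i)] ([weakly_basic_family_bijection]), and the form transfers. *)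

(** * Linear maps, subspaces and internal direct sums *)

Section Linearity.
Context {K : fieldType}.

Lemma lin0 (U W : lmodType K) (f : U -> W) : linear f -> f 0 = 0.
Proof.
by move=> lf; have := lf (-1) 0 0; rewrite scaler0 addr0 scaleN1r addNr.
Qed.

Lemma linZ (U W : lmodType K) (f : U -> W) k x :
  linear f -> f (k *: x) = k *: f x.
Proof. by move=> lf; rewrite -[k *: x]addr0 lf lin0 // addr0. Qed.

Lemma linD (U W : lmodType K) (f : U -> W) x y :
  linear f -> f (x + y) = f x + f y.
Proof. by move=> lf; rewrite -[x in LHS]scale1r lf scale1r. Qed.

Lemma linN (U W : lmodType K) (f : U -> W) x : linear f -> f (- x) = - f x.
Proof. by move=> lf; rewrite -!scaleN1r linZ. Qed.

Lemma linB (U W : lmodType K) (f : U -> W) x y :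
  linear f -> f (x - y) = f x - f y.
Proof. by move=> lf; rewrite linD // linN. Qed.

Lemma lin_sum (U W : lmodType K) (f : U -> W) T (s : seq T) P (F : T -> U) :
  linear f -> f (\sum_(i <- s | P i) F i) = \sum_(i <- s | P i) f (F i).
Proof.
by move=> lf; apply: (big_morph f) => [x y|]; [apply: linD | apply: lin0].
Qed.

End Linearity.

Section Subspaces.
Context {K : fieldType} {A : nualgType K}.
Implicit Types (x y : A) (V S T : set A).

Lemma nmul_suml J (s : seq J) P (F : J -> A) y :
  (\sum_(i <- s | P i) F i) ** y = \sum_(i <- s | P i) F i ** y.
Proof.
apply: (big_morph (nmul^~ y)) => [a b|]; first exact: nmulDl.
exact: nmul0l.
Qed.

Lemma nmul_sumr J (s : seq J) P (F : J -> A) y :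
  y ** (\sum_(i <- s | P i) F i) = \sum_(i <- s | P i) y ** F i.
Proof.
apply: (big_morph (nmul y)) => [a b|]; first exact: nmulDr.
exact: nmul0r.
Qed.

Lemma subspace0 V : subspace V -> V 0. Proof. by case. Qed.

Lemma subspaceD V x y : subspace V -> V x -> V y -> V (x + y).
Proof. by move=> [_ VD] Vx; rewrite -[x]scale1r; apply: VD. Qed.

Lemma subspaceZ V k x : subspace V -> V x -> V (k *: x).
Proof. by move=> [V0 VD] Vx; rewrite -[_ *: x]addr0; apply: VD. Qed.

Lemma subspaceN V x : subspace V -> V x -> V (- x).
Proof. by rewrite -scaleN1r; apply: subspaceZ. Qed.

Lemma subspaceB V x y : subspace V -> V x -> V y -> V (x - y).
Proof. by move=> sV Vx Vy; apply: subspaceD => //; apply: subspaceN. Qed.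

Lemma subspace_sum V (J : eqType) (s : seq J) (P : pred J) (F : J -> A) :
  subspace V -> (forall i, i \in s -> P i -> V (F i)) ->
  V (\sum_(i <- s | P i) F i).
Proof.
move=> sV VF; rewrite big_seq_cond; apply: big_ind => [|x y|i /andP[]].
- exact: subspace0.
- exact: subspaceD.
- exact: VF.
Qed.

Lemma subspace_finite_sums S :
  (forall k x, S x -> S (k *: x)) -> subspace (finite_sums S).
Proof.
move=> SZ; split=> [|k x y [s Ss ->] [t St ->]].
  by exists [::] => //; rewrite big_nil.
exists ([seq k *: z | z <- s] ++ t).
  by move=> z; rewrite mem_cat => /orP[/mapP[w /Ss sw ->]|/St //]; apply: SZ.
by rewrite big_cat big_map scaler_sumr.
Qed.

Lemma finite_sums_sub S V : subspace V -> S `<=` V -> finite_sums S `<=` V.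
Proof.
by move=> sV SV x [s Ss ->]; apply: subspace_sum => // i /Ss /SV.
Qed.

Lemma mem_finite_sums S x : S x -> finite_sums S x.
Proof.
by exists [:: x]; rewrite ?big_seq1 // => y; rewrite mem_seq1 => /eqP->.
Qed.

Lemma cornerP (a b : A) S x : a ** a = a -> b ** b = b ->
  corner a b S x -> a ** x = x /\ x ** b = x.
Proof. by move=> aa bb [y _ <-]; rewrite !nmulA aa -!nmulA bb. Qed.

End Subspaces.

Section Components.
Context {K : fieldType} {A : nualgType K} {T : eqType}.
Variable V : T -> set A.
Implicit Types (x y : A) (f : T -> A).

Definition decomposition x f : Prop :=
  (forall i, V i (f i)) /\
  exists s, [/\ uniq s, forall i, i \notin s -> f i = 0
              & x = \sum_(i <- s) f i].

(** The [i]-th coordinate in an internal direct sum; it is chosen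
    classically and meaningful only when the sum is direct. *)
Definition component (i : T) x : A :=
  xget 0 [set y | exists2 f, decomposition x f & y = f i].

Lemma decomposition_sum x f : decomposition x f ->
  exists s0 : seq T, forall s, uniq s -> {subset s0 <= s} ->
    x = \sum_(i <- s) f i.
Proof.
move=> [_ [s0 [u0 f0 ->]]]; exists s0 => s us sub.
rewrite [RHS](bigID (mem s0)) /= [X in _ + X]big1 ?addr0 => [|i /f0 //].
rewrite -[RHS]big_filter; apply: perm_big; apply: uniq_perm => //.
  exact: filter_uniq.
move=> i; rewrite mem_filter.
by case: (boolP (i \in s0)) => //= si; rewrite sub.
Qed.

Hypothesis dV : internal_direct_sum V.

(** A sum over a sequence with repetitions becomes a finitely supported
    decomposition once each term is multiplied by its multiplicity. *)
Lemma decomposition_exists x : exists f, decomposition x f.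
Proof.
have [sV + _] := dV => /(_ x)[s [f Vf ->]].
exists (fun i => (count_mem i s)%:R *: f i); split.
  by move=> i; apply: subspaceZ.
exists (undup s); split; first exact: undup_uniq.
  by move=> i; rewrite mem_undup => /count_memPn ->; rewrite scale0r.
rewrite -big_undup_iterop_count; apply: eq_bigr => i _.
by rewrite scaler_nat.
Qed.

(** Subtract and sum over a common support: directness makes every
    difference vanish. *)
Lemma decomposition_uniq x f g :
  decomposition x f -> decomposition x g -> forall i, f i = g i.
Proof.
move=> df dg; have [sf Ef] := decomposition_sum df.
have [sg Eg] := decomposition_sum dg.
have [[Vf _] [Vg _]] := (df, dg); have [sV _ dV'] := dV.
move=> i; pose s := undup (i :: sf ++ sg).
apply/eqP; rewrite -subr_eq0; apply/eqP.
apply: (dV' s (fun i => f i - g i)); first exact: undup_uniq.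
- by move=> j; apply: subspaceB.
- rewrite sumrB -Ef ?undup_uniq // => [|j sj].
    rewrite -Eg ?undup_uniq ?subrr // => j sj.
    by rewrite mem_undup inE mem_cat sj !orbT.
  by rewrite mem_undup inE mem_cat sj !orbT.
- by rewrite mem_undup inE eqxx.
Qed.

Lemma componentE x f i : decomposition x f -> component i x = f i.
Proof.
move=> df; apply: xget_unique; first by exists f.
by move=> y [g dg ->]; apply: decomposition_uniq dg df i.
Qed.

Lemma component_decomposition x : decomposition x (component^~ x).
Proof.
have [f df] := decomposition_exists x.
by have -> : component^~ x = f by apply: funext => i; apply: componentE.
Qed.

Lemma mem_component i x : V i (component i x).
Proof. by have [] := component_decomposition x. Qed.

(** By uniqueness of decompositions it is enough to exhibit one for
    [k *: x + y]. *)
Lemma component_linear i : linear (component i).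
Proof.
move=> k x y; have [[sV _ _] dx dy] :=
  And3 dV (component_decomposition x) (component_decomposition y).
have [sx Ex] := decomposition_sum dx; have [sy Ey] := decomposition_sum dy.
apply: (@componentE _ (fun i => k *: component i x + component i y)).
split=> [j|]; first by apply: subspaceD => //; [apply: subspaceZ|];
  rewrite //; apply: mem_component.
have [_ [tx [_ tx0 _]]] := dx; have [_ [ty [_ ty0 _]]] := dy.
exists (undup (sx ++ sy ++ tx ++ ty)); split; first exact: undup_uniq.
  move=> j; rewrite mem_undup !mem_cat !negb_or => /and4P[_ _ jx jy].
  by rewrite tx0 // ty0 // scaler0 addr0.
rewrite big_split -scaler_sumr /= -Ex ?undup_uniq -?Ey ?undup_uniq //.
  by move=> j js; rewrite mem_undup !mem_cat js ?orbT.
by move=> j js; rewrite mem_undup !mem_cat js ?orbT.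
Qed.

Lemma component_in i j x : V j x -> component i x = if i == j then x else 0.
Proof.
move=> Vx; have [sV _ _] := dV.
apply: (@componentE _ (fun i => if i == j then x else 0)).
split=> [l|]; first by case: eqP => [->|_] //; apply: subspace0.
exists [:: j]; split=> //; last by rewrite big_seq1 eqxx.
by move=> l; rewrite inE => /negPf->.
Qed.

Lemma component_id i x : V i x -> component i x = x.
Proof. by move/component_in->; rewrite eqxx. Qed.

Lemma component_neq i j x : V j x -> i != j -> component i x = 0.
Proof. by move/component_in-> => /negPf->. Qed.

Lemma component_sum x :
  exists2 s, uniq s & x = \sum_(i <- s) component i x.
Proof. by have [_ [s [us _ ?]]] := component_decomposition x; exists s. Qed.

Lemma component_sum_at k x :
  exists s, [/\ uniq s, k \in s & x = \sum_(i <- s) component i x].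
Proof.
have [s0 sE] := decomposition_sum (component_decomposition x).
exists (undup (k :: s0)); rewrite undup_uniq mem_undup mem_head; split=> //.
by apply: sE => [|i si]; rewrite ?undup_uniq // mem_undup in_cons si orbT.
Qed.

End Components.

(** * Graded algebras with enough idempotents *)

Section GradedFamily.
Context {K : fieldType} {A : nualgType K} (gr : int -> set A).
Hypothesis grG : is_grading gr.
Implicit Types (x y : A).

Local Notation comp := (component gr).

Let dgr : internal_direct_sum gr. Proof. by case: grG. Qed.
Let grM g h x y : gr g x -> gr h y -> gr (g + h) (x ** y).
Proof. by case: grG => _; apply. Qed.

Lemma grading_subspace h : subspace (gr h).
Proof. by case: dgr. Qed.

Lemma grading_ind (P : A -> Prop) : P 0 ->
  (forall x y, P x -> P y -> P (x + y)) -> (forall h x, gr h x -> P x) ->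
  forall x, P x.
Proof.
move=> P0 PD Pgr x; have [s _ ->] := component_sum dgr x.
elim/big_ind: _ => // h _; apply: (Pgr h); exact: mem_component.
Qed.

(** Multiplication by an element of degree zero preserves each [gr h]. *)
Lemma component_mull h a x : gr 0 a -> comp h (a ** x) = a ** comp h x.
Proof.
move=> a0; elim/grading_ind: x => [|x y IHx IHy|k x kx].
- by rewrite nmul0r !(lin0 (component_linear dgr h)) nmul0r.
- by rewrite nmulDr !(linD _ _ (component_linear dgr h)) nmulDr IHx IHy.
have kax : gr k (a ** x) by rewrite -[k]add0r; apply: grM.
rewrite (component_in dgr _ kax) (component_in dgr _ kx).
by case: eqP => // _; rewrite nmul0r.
Qed.

Lemma component_mulr h a x : gr 0 a -> comp h (x ** a) = comp h x ** a.
Proof.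
move=> a0; elim/grading_ind: x => [|x y IHx IHy|k x kx].
- by rewrite nmul0l !(lin0 (component_linear dgr h)) nmul0l.
- by rewrite nmulDl !(linD _ _ (component_linear dgr h)) nmulDl IHx IHy.
have kax : gr k (x ** a) by rewrite -[k]addr0; apply: grM.
rewrite (component_in dgr _ kax) (component_in dgr _ kx).
by case: eqP => // _; rewrite nmul0l.
Qed.

Section Positive.
Hypothesis pos : forall h : int, h < 0 -> gr h = [set 0].

(** Negative degrees being absent, a product of homogeneous elements has
    degree zero only if both factors do. *)
Lemma component0M x y : comp 0 (x ** y) = comp 0 x ** comp 0 y.
Proof.
have cD := linD _ _ (component_linear dgr 0).
have c0 := lin0 (component_linear dgr 0).
elim/grading_ind: x => [|x1 x2 IH1 IH2|p x px].
- by rewrite !(nmul0l, c0).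
- by rewrite !(nmulDl, cD) IH1 IH2.
elim/grading_ind: y => [|y1 y2 IH1 IH2|q y qy].
- by rewrite !(nmul0r, c0).
- by rewrite !(nmulDr, cD) IH1 IH2.
have [p0|p0] := ltP p 0.
  by move: px; rewrite pos // => ->; rewrite !(nmul0l, c0).
have [q0|q0] := ltP q 0.
  by move: qy; rewrite pos // => ->; rewrite !(nmul0r, c0).
rewrite (component_in dgr _ (grM px qy)) (component_in dgr _ px).
rewrite (component_in dgr _ qy) ![0 == _]eq_sym paddr_eq0 //.
by do 2![case: eqP => _ //=]; rewrite ?nmul0l ?nmul0r.
Qed.

End Positive.

Section Distinguished.
Context {I : choiceType} (e : I -> A).
Hypothesis De : distinguished_family gr e.

Lemma family_degree0 i : gr 0 (e i). Proof. by case: De => /(_ i)[]. Qed.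
Lemma family_neq0 i : e i <> 0. Proof. by case: De => /(_ i)[]. Qed.
Lemma family_idem i : e i ** e i = e i. Proof. by case: De. Qed.
Lemma family_mul i j : e i ** e j = if i == j then e i else 0.
Proof.
by case: eqVneq => [->|ij]; [apply: family_idem | case: De => _ _ ->].
Qed.

Lemma family_scale_inj i : injective (fun c : K => c *: e i).
Proof.
move=> c d /eqP; rewrite -subr_eq0 -scalerBl scaler_eq0 subr_eq0.
by case/orP => /eqP // /family_neq0.
Qed.

Lemma family_inj : injective e.
Proof.
move=> i j eij; apply/eqP; case: eqVneq => // ij.
have := family_mul i j; rewrite (negPf ij) -eij family_idem.
by move/family_neq0.
Qed.

Lemma sum_family_mull (s : seq I) i : uniq s -> i \in s ->
  (\sum_(j <- s) e j) ** e i = e i.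
Proof.
move=> us si; rewrite nmul_suml (bigD1_seq i) //= family_idem big1 ?addr0 //.
by move=> j ji; rewrite family_mul (negPf ji).
Qed.

Lemma sum_family_mulr (s : seq I) i : uniq s -> i \in s ->
  e i ** (\sum_(j <- s) e j) = e i.
Proof.
move=> us si; rewrite nmul_sumr (bigD1_seq i) //= family_idem big1 ?addr0 //.
by move=> j ji; rewrite family_mul eq_sym (negPf ji).
Qed.

(** Both Peirce decompositions of [x] have finite support, and the sum of the
    idempotents in the union of the supports fixes [x] on either side. This
    replaces the missing unit of [A]. *)
Lemma local_unit x : exists s, [/\ uniq s, (\sum_(i <- s) e i) ** x = x
  & x ** (\sum_(i <- s) e i) = x].
Proof.
case: De => _ _ _ [_ /(_ x)[s [f ef xf]] _] [_ /(_ x)[t [g eg xg]] _].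
exists (undup (s ++ t)); split; first exact: undup_uniq.
  rewrite xf nmul_sumr; apply: eq_big_seq => i si; have [a _ <-] := ef i.
  by rewrite nmulA sum_family_mull ?undup_uniq // mem_undup mem_cat si.
rewrite xg nmul_suml; apply: eq_big_seq => i si; have [a _ <-] := eg i.
by rewrite -nmulA sum_family_mulr ?undup_uniq // mem_undup mem_cat si orbT.
Qed.

Lemma left_peirce_sum x : exists2 s, uniq s & x = \sum_(i <- s) e i ** x.
Proof.
by have [s [us xs _]] := local_unit x; exists s; rewrite -?nmul_suml ?xs.
Qed.

Lemma right_peirce_sum x : exists2 s, uniq s & x = \sum_(i <- s) x ** e i.
Proof.
by have [s [us _ xs]] := local_unit x; exists s; rewrite -?nmul_sumr ?xs.
Qed.

Lemma left_peirce_eq0 x : (forall i, e i ** x = 0) -> x = 0.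
Proof. by move=> x0; have [s _ ->] := left_peirce_sum x; apply: big1. Qed.

Lemma right_peirce_eq0 x : (forall i, x ** e i = 0) -> x = 0.
Proof. by move=> x0; have [s _ ->] := right_peirce_sum x; apply: big1. Qed.

Lemma peirce_eq0 x : (forall i j, e i ** x ** e j = 0) -> x = 0.
Proof.
move=> x0; apply: left_peirce_eq0 => i; apply: right_peirce_eq0 => j.
exact: x0.
Qed.

Lemma peirce_ind (P : A -> Prop) : P 0 ->
  (forall x y, P x -> P y -> P (x + y)) ->
  forall x, (forall i j, P (e i ** x ** e j)) -> P x.
Proof.
move=> P0 PD x Px; have [s _ ->] := left_peirce_sum x.
elim/big_ind: _ => // i _; have [t _ ->] := right_peirce_sum (e i ** x).
exact: big_ind.
Qed.

Lemma degree_peirce h i j x : gr h x -> gr h (e i ** x ** e j).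
Proof.
by move=> hx; rewrite -[h]add0r -[0 + h]addr0; apply: (grM (grM _ hx));
  apply: family_degree0.
Qed.

Lemma family_cornerP i j V x :
  corner (e i) (e j) V x -> e i ** x = x /\ x ** e j = x.
Proof. by apply: cornerP; apply: family_idem. Qed.

Lemma corner_gradedE i j h x :
  corner (e i) (e j) (gr h) x <-> gr h x /\ e i ** x ** e j = x.
Proof.
split=> [cx|[hx <-]]; last by exists x.
have [-> ->] := family_cornerP cx; split=> //.
by have [a ha <-] := cx; apply: degree_peirce.
Qed.

Lemma sum_family_degree0 (s : seq I) : gr 0 (\sum_(i <- s) e i).
Proof.
apply: subspace_sum => [|i _ _]; first exact: grading_subspace.
exact: family_degree0.
Qed.

Section Semisimple.
Hypothesis pos : forall h : int, h < 0 -> gr h = [set 0].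
Hypothesis ss : semisimple_algebra (gr 0).

Let gr0M x y : gr 0 x -> gr 0 y -> gr 0 (x ** y).
Proof. by move=> x0 y0; rewrite -[0]addr0; apply: grM. Qed.

(** Right multiplication by [y] maps [gr 0] onto the simple module [L], and the
    annihilator of [y] is its kernel. *)
Lemma maximal_left_annihilator L y : minimal_left_ideal (gr 0) L -> L y ->
  y <> 0 -> maximal_left_ideal (gr 0) [set a | gr 0 a /\ a ** y = 0].
Proof.
move=> [[Lgr sL ML] _ minL] Ly y0; have sg := grading_subspace 0.
split.
- split=> [a []//||a x a0 [x0 xy]]; last first.
    by split; [apply: gr0M | rewrite -nmulA xy nmul0r].
  split=> [|k a b [a0 ay] [b0 bY]].
    by split; [apply: subspace0 | apply: nmul0l].
  split; first by apply: subspaceD => //; apply: subspaceZ.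
  by rewrite nmulDl -nscaleAl ay bY scaler0 addr0.
- move=> M0; have [s [_ sy _]] := local_unit y.
  suff [_] : [set a | gr 0 a /\ a ** y = 0] (\sum_(i <- s) e i) by rewrite sy.
  by rewrite M0; apply: sum_family_degree0.
move=> L' [L'gr sL' ML'] sub.
pose Ly' := [set a ** y | a in L'].
have lLy : left_ideal (gr 0) Ly'.
  split=> [_ [a /L'gr a0 <-]||a _ a0 [b L'b <-]].
  - by apply: gr0M => //; apply: Lgr.
  - split=> [|k _ _ [a La <-] [b Lb <-]].
      by exists 0; [apply: subspace0 | apply: nmul0l].
    exists (k *: a + b); first by apply: subspaceD => //; apply: subspaceZ.
    by rewrite nmulDl nscaleAl.
  - by exists (a ** b); [apply: ML' | rewrite nmulA].
have [|Ly'0|Ly'L] := minL _ lLy.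
- by move=> _ [a La <-]; apply: ML => //; apply: L'gr.
- left; apply/seteqP; split=> // a La; split; first exact: L'gr.
  have : Ly' (a ** y) by exists a.
  by rewrite Ly'0.
right; apply/seteqP; split=> // b b0.
have : L (b ** y) by apply: ML.
rewrite -Ly'L => -[a L'a aby]; rewrite -[b](subrK a).
apply: subspaceD => //; apply: sub; split.
  by apply: subspaceB => //; apply: L'gr.
by rewrite nmulDl nmulNl aby subrr.
Qed.

(** The radical annihilates each simple left ideal, these span [gr 0], and
    [gr 0] contains a right unit for [x]. *)
Lemma semisimple_radical x : jacobson_radical (gr 0) x -> x = 0.
Proof.
move=> [x0 Jx].
have ann y : gr 0 y -> x ** y = 0.
  move/ss => [s Ss ->]; rewrite nmul_sumr big_seq big1 // => z /Ss[L mL Lz].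
  have [->|/eqP z0] := eqVneq z 0; first exact: nmul0r.
  by have [] := Jx _ (maximal_left_annihilator mL Lz z0).
by have [s [_ _ <-]] := local_unit x; apply: ann; apply: sum_family_degree0.
Qed.

(** This set is [L + A_{>0}]. A graded left ideal containing it meets [gr 0] in
    [L], and is then equal to it by homogeneity, or in [gr 0], and then contains
    all local units. *)
Lemma maximal_graded_extension L : maximal_left_ideal (gr 0) L ->
  maximal_graded_left_ideal gr [set x | L (comp 0 x)].
Proof.
have cl := component_linear dgr 0.
have c0 x : gr 0 x -> comp 0 x = x by apply: component_id.
move=> [[Lgr sL ML] Lne maxL].
split.
- split; first split=> //.
  + split=> [|k x y Lx Ly] /=; first by rewrite lin0 //; apply: subspace0.
    by rewrite cl; apply: subspaceD => //; apply: subspaceZ.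
  + move=> a x _ Lx /=; rewrite component0M //; apply: ML => //.
    exact: mem_component.
  move=> x Lx; have [s _ xs] := component_sum dgr x.
  exists s, (comp^~ x) => // h; split; first exact: mem_component.
  rewrite /= (component_in dgr _ (mem_component dgr h x)).
  by case: eqP => [<- //|_]; apply: subspace0.
- move=> LT; apply: Lne; apply/seteqP; split=> // x x0.
  have : [set x | L (comp 0 x)] x by rewrite LT.
  by rewrite /= c0.
move=> L' [[_ sL' ML'] hL'] sub.
have lL0 : left_ideal (gr 0) (L' `&` gr 0).
  split=> [x []//||a x a0 [L'x x0]]; last by split; [apply: ML'|apply: gr0M].
  have sg := grading_subspace 0.
  split; first by split; apply: subspace0.
  by move=> k x y [? ?] [? ?]; split; apply: subspaceD => //; apply: subspaceZ.
have [|L0L|L0T] := maxL _ lL0.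
- by move=> x Lx; split; [apply: sub; rewrite /= c0 //|]; apply: Lgr.
- left; apply/seteqP; split=> // x /hL'[s [f Lf ->]] /=.
  rewrite lin_sum //; apply: subspace_sum => // h _ _.
  have [hf L'f] := Lf h; rewrite (component_in dgr _ hf).
  case: eqP => [h0|_]; last exact: subspace0.
  by rewrite -L0L; split=> //; rewrite h0.
right; apply/seteqP; split=> // x _; have [s [_ _ <-]] := local_unit x.
apply: ML' => //.
suff [] : (L' `&` gr 0) (\sum_(i <- s) e i) by [].
by rewrite L0T; apply: sum_family_degree0.
Qed.

Lemma degree0_graded_radical x :
  gr 0 x -> graded_jacobson_radical gr x -> x = 0.
Proof.
move=> x0 Jx; apply: semisimple_radical; split=> // L mL.
by have := Jx _ (maximal_graded_extension mL); rewrite /= component_id.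
Qed.

Hypothesis Wb : weakly_basic_family gr e.
Hypothesis Sp : split_family gr e.

(** The element lies in the graded radical because the family is weakly
    basic, hence vanishes in degree zero. *)
Lemma degree0_corner_neq i j x : gr 0 x -> i != j -> e i ** x ** e j = 0.
Proof.
move=> x0 ij; apply: degree0_graded_radical; first exact: degree_peirce.
by case: Wb => _ _ _ /(_ i j ij); apply; exists x.
Qed.

(** Since the radical of [gr 0] is zero, the splitting map of [e_i A_0 e_i]
    is injective; it sends [e_i] to [1]. *)
Lemma degree0_corner i x : gr 0 x -> exists c, e i ** x ** e i = c *: e i.
Proof.
have [f [flin fM _ fker]] := Sp i; set S := corner _ _ _ in flin fM fker.
have Se : S (e i).
  by exists (e i); rewrite ?family_idem //; apply: family_degree0.
have fe0 : f (e i) != 0.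
  apply/eqP => /(fker _ Se) [z /semisimple_radical->].
  by rewrite nmul0r nmul0l => /esym /family_neq0.
have fe1 : f (e i) = 1.
  by apply: (mulfI fe0); rewrite mulr1 -fM // family_idem.
move=> x0; exists (f (e i ** x ** e i)).
set y := _ ** _ ** _; have Sy : S y by exists x.
have sS : S (- f y *: e i + y).
  exists (- f y *: e i + x).
    apply: subspaceD => //; try exact: grading_subspace.
    by apply: subspaceZ; [apply: grading_subspace | apply: family_degree0].
  by rewrite nmulDr nmulDl -nscaleAr -nscaleAl !family_idem.
have : f (- f y *: e i + y) = 0 by rewrite flin // fe1 mulr1 addNr.
move/(fker _ sS) => [z /semisimple_radical->].
rewrite nmul0r nmul0l => /esym/eqP.
by rewrite scaleNr addrC subr_eq0 => /eqP.
Qed.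

(** The two previous facts say that [gr 0] acts on each [e i] by scalars.
    This is the form in which semisimplicity, splitness and the radical
    conditions enter all that follows. *)
Lemma degree0_mull i x : gr 0 x -> exists c,
  e i ** x = c *: e i /\ x ** e i = c *: e i.
Proof.
move=> x0; have [c cx] := degree0_corner i x0; exists c; split.
  apply/eqP; rewrite -subr_eq0; apply/eqP; apply: right_peirce_eq0 => j.
  rewrite nmulDl nmulNl -nscaleAl family_mul.
  case: eqVneq => [<-|ij]; first by rewrite cx subrr.
  by rewrite degree0_corner_neq // scaler0 subr0.
apply/eqP; rewrite -subr_eq0; apply/eqP; apply: left_peirce_eq0 => j.
rewrite nmulDr nmulNr -nscaleAr family_mul nmulA eq_sym.
case: eqVneq => [<-|ij]; first by rewrite cx subrr.
by rewrite degree0_corner_neq 1?eq_sym // scaler0 subr0.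
Qed.

End Semisimple.
End Distinguished.
End GradedFamily.

(** * Decomposable elements and coordinates of arrows *)

Section LinearAlgebraModulo.
Context {K : fieldType} {A : nualgType K}.
Variable N : set A.
Hypothesis sN : subspace N.
Implicit Types (a : nat -> K) (b g : nat -> A).

(** Families are indexed by all of [nat], only the first [n] vectors being
    relevant; this makes appending a vector painless. *)
Definition free_modulo (n : nat) b : Prop :=
  forall a, N (\sum_(k < n) a k *: b k) -> forall k, (k < n)%N -> a k = 0.

Definition spanned_modulo (n : nat) b (x : A) : Prop :=
  exists a, N (x - \sum_(k < n) a k *: b k).

(** The exchange inequality: more vectors than generators admit a linear
    relation, given by a row vector killed by the matrix of coefficients. *)
Lemma free_modulo_leq n m b g : free_modulo n b ->
  (forall k, (k < n)%N -> spanned_modulo m g (b k)) -> (n <= m)%N.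
Proof.
move=> fb sb; rewrite leqNgt; apply/negP => mn.
have /choice[a Na] : forall k : 'I_n, exists a : nat -> K,
    N (b k - \sum_(l < m) a l *: g l).
  by move=> k; apply: sb.
pose M := \matrix_(k < n, l < m) a k l.
have : kermx M != 0.
  rewrite kermx_eq0 -row_leq_rank -ltnNge.
  exact: leq_ltn_trans (rank_leq_col M) mn.
case/rowV0Pn => v /sub_kermxP vM /negP; apply; apply/eqP/rowP => k.
(* [free_modulo] wants coefficients indexed by [nat]: pad with zeros. *)
pose v' l := oapp (v 0) 0 (insub l : option 'I_n).
have v'E (l : 'I_n) : v' l = v 0 l by rewrite /v' valK.
rewrite mxE -v'E; apply: (fb v') => //.
have -> : \sum_(k < n) v' k *: b k =
    \sum_(k < n) v' k *: (b k - \sum_(l < m) a k l *: g l).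
  apply/eqP; rewrite -subr_eq0 -sumrB; apply/eqP.
  under eq_bigr => l _ do rewrite -scalerBr opprB addrC subrK scaler_sumr.
  rewrite exchange_big /= big1 // => l _.
  under eq_bigr => l' _ do rewrite scalerA.
  rewrite -scaler_suml; have /rowP/(_ l) := vM; rewrite !mxE.
  under eq_bigr do rewrite mxE.
  by under [in X in _ -> X]eq_bigr do rewrite v'E; move=> ->; rewrite scale0r.
by apply: subspace_sum => // l _ _; apply: subspaceZ.
Qed.

(** A free family of maximal size generates. *)
Lemma basis_modulo (V : set A) : subspace V -> finite_dimensional V ->
  exists n b, [/\ forall k, V (b k), free_modulo n b
                & forall x, V x -> spanned_modulo n b x].
Proof.
move=> sV [s Vs].
pose P n := `[< exists2 b, (forall k, V (b k)) & free_modulo n b >].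
have P0 : exists n, P n.
  exists 0%N; apply/asboolP; exists (fun=> 0) => // k; exact: subspace0.
have Pm n : P n -> (n <= size s)%N.
  move=> /asboolP[b Vb fb]; apply: (free_modulo_leq fb (g := nth 0 s)) => k _.
  have [c bc] := Vs _ (Vb k); exists c; rewrite -bc subrr.
  exact: subspace0.
case: (ex_maxnP P0 Pm) => n /asboolP[b Vb fb] maxn; exists n, b; split=> // x Vx.
apply: contrapT => nx; suff /maxn : P n.+1 by rewrite ltnn.
apply/asboolP; exists (fun k => if (k < n)%N then b k else x).
  by move=> k; case: ifP.
move=> a; rewrite big_ord_recr /= ltnn.
under eq_bigr => k _ do rewrite ltn_ord.
move=> Nax; have an : a n = 0.
  apply: contrapT => /eqP an; apply: nx; exists (fun k => - (a n)^-1 * a k).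
  (* The coefficient of [x] is nonzero: solve for [x]. *)
  have := subspaceZ (a n)^-1 sN Nax.
  rewrite scalerDr scalerA mulVf // scale1r addrC scaler_sumr -sumrN.
  congr (N (_ + _)); apply: eq_bigr => k _.
  by rewrite scalerA mulNr scaleNr opprK.
move: Nax; rewrite an scale0r addr0 => /fb ab k.
by rewrite ltnS leq_eqVlt => /orP[/eqP->|/ab].
Qed.

End LinearAlgebraModulo.

Section Decomposables.
Context {K : fieldType} {A : nualgType K} (gr : int -> set A).
Hypothesis grG : is_grading gr.

(** The degree [h] part of the square of the ideal of elements of positive
    degree. *)
Definition decomposable (h : int) : set A :=
  finite_sums [set x | exists p q s t,
    [/\ 0 < p, 0 < q, p + q = h, gr p s & gr q t /\ x = s ** t]].

Lemma decomposable_subspace h : subspace (decomposable h).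
Proof.
apply: subspace_finite_sums => k x [p [q [s [t [p0 q0 pq ps [qt ->]]]]]].
exists p, q, (k *: s), t; split=> //; last by rewrite nscaleAl.
exact: subspaceZ (grading_subspace grG p) ps.
Qed.

Lemma decomposable_mul p q s t :
  0 < p -> 0 < q -> gr p s -> gr q t -> decomposable (p + q) (s ** t).
Proof. by move=> *; apply: mem_finite_sums; exists p, q, s, t. Qed.

Lemma decomposable_degree h : decomposable h `<=` gr h.
Proof.
apply: finite_sums_sub; first exact: grading_subspace.
move=> x [p [q [s [t [_ _ <- ps [qt ->]]]]]].
by case: grG => _; apply.
Qed.

Context {I : choiceType} (e : I -> A).
Hypothesis De : distinguished_family gr e.

Lemma decomposable_peirce h i j x :
  decomposable h x -> decomposable h (e i ** x ** e j).
Proof.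
move=> [s Ss ->]; rewrite nmul_sumr nmul_suml; apply: subspace_sum.
  exact: decomposable_subspace.
move=> x' /Ss[p [q [y [z [p0 q0 <- py [qz ->]]]]]] _.
rewrite nmulA -nmulA; apply: decomposable_mul => //.
  by rewrite -[p]add0r; case: grG => _; apply=> //; apply: (family_degree0 De).
by rewrite -[q]addr0; case: grG => _; apply=> //; apply: (family_degree0 De).
Qed.

Hypothesis lfd : locally_finite_dimensional gr e.

Let comp := component gr.
Let dgr : internal_direct_sum gr. Proof. by case: grG. Qed.

(** [b 0, ..., b (n - 1)] is a basis of [e_i A_h e_j] modulo decomposables,
    and the functionals [c k] on [A] read off its coordinates: they factor
    through the projection of [A] onto [e_i A_h e_j] and kill decomposables. *)
Definition arrow_coordinates i j h n (b : nat -> A) (c : nat -> A -> K) : Prop :=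
  [/\ forall k, corner (e i) (e j) (gr h) (b k),
      forall k, linear (c k : A -> K^o),
      forall k l, (k < n)%N -> (l < n)%N -> c k (b l) = (k == l)%:R,
      forall k x, (k < n)%N -> decomposable h x -> c k x = 0
    & (forall k x, c k x = c k (e i ** comp h x ** e j)) /\
      forall x, corner (e i) (e j) (gr h) x ->
        decomposable h (x - \sum_(k < n) c k x *: b k)].

(** Coordinates modulo decomposables are unique by freeness, hence linear.
    They extend to [A] by the projection [x |-> e_i x_h e_j], which preserves
    decomposability. *)
Lemma exists_arrow_coordinates i j h :
  exists n b c, arrow_coordinates i j h n b c.
Proof.
have sN := decomposable_subspace h; have sg := grading_subspace grG h.
have sV : subspace (corner (e i) (e j) (gr h)).
  split=> [|k x y /(corner_gradedE grG De)[hx xE] /(corner_gradedE grG De)[hy yE]].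
    by exists 0; [apply: subspace0 | rewrite nmul0r nmul0l].
  apply/(corner_gradedE grG De); split.
    by apply: subspaceD => //; apply: subspaceZ.
  by rewrite nmulDr nmulDl -nscaleAr -nscaleAl xE yE.
have [n [b [Vb fb Sb]]] := basis_modulo sN sV (lfd i j h).
pose pi x := e i ** comp h x ** e j.
have Vpi x : corner (e i) (e j) (gr h) (pi x).
  by exists (comp h x) => //; apply: mem_component.
have /choice[c Nc] : forall x, exists a : nat -> K,
   decomposable h (pi x - \sum_(k < n) a k *: b k) by move=> x; apply: Sb.
have pilin : linear pi.
  move=> k x y; rewrite /pi /comp (component_linear dgr).
  by rewrite nmulDr nmulDl -nscaleAr -nscaleAl.
have piid x : corner (e i) (e j) (gr h) x -> pi x = x.
  by move=> /(corner_gradedE grG De)[hx xE]; rewrite /pi /comp component_id.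
have cE x (a : nat -> K) : decomposable h (pi x - \sum_(k < n) a k *: b k) ->
    forall k, (k < n)%N -> c x k = a k.
  move=> Na k kn; apply/eqP; rewrite -subr_eq0; apply/eqP.
  apply: (fb (fun k => c x k - a k)) => //.
  have := subspaceB sN Na (Nc x); rewrite opprB addrC addrA subrK -sumrB.
  by under [in X in _ -> X]eq_bigr => l _ do rewrite scalerBl.
pose c' k x := if (k < n)%N then c x k else 0.
exists n, b, c'; split=> //.
- move=> k r x y; rewrite /c'; case: ifP => [kn|_]; last by rewrite scaler0 addr0.
  apply: (cE _ (fun k => r * c x k + c y k)) => //.
  have := subspaceD sN (subspaceZ r sN (Nc x)) (Nc y).
  rewrite pilin scalerBr scaler_sumr addrACA -opprD -big_split /=.
  congr (decomposable h (_ - _)); apply: eq_bigr => l _.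
  by rewrite scalerDl scalerA.
- move=> k l kn ln; rewrite /c' kn (cE _ (fun k => (k == l)%:R)) //.
  rewrite piid // (bigD1 (Ordinal ln)) //= eqxx scale1r big1 ?addr0 ?subrr.
    exact: subspace0.
  move=> m; rewrite -val_eqE /= => /negPf ->; exact: scale0r.
- move=> k x kn Nx; rewrite /c' kn (cE _ (fun=> 0)) //.
  rewrite big1 => [|l _]; last exact: scale0r.
  rewrite subr0 /pi /comp component_id //; last exact: decomposable_degree.
  exact: decomposable_peirce.
split=> [k x|x Vx]; first rewrite /c'; first case: ifP => // kn.
  apply: cE => //; have := Nc (pi x).
  by rewrite (piid (pi x)).
have := Nc x; rewrite piid //; congr (decomposable h (_ - _)).
by apply: eq_bigr => k _; rewrite /c' ltn_ord.
Qed.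

End Decomposables.

Section DegreeZero.
Context {K : fieldType} {A : nualgType K} (gr : int -> set A).
Context {I : choiceType} (e : I -> A).
Hypothesis grG : is_grading gr.
Hypothesis De : distinguished_family gr e.
Hypothesis e0 : forall i x, gr 0 x ->
  exists c, e i ** x = c *: e i /\ x ** e i = c *: e i.

Let dgr : internal_direct_sum gr. Proof. by case: grG. Qed.

(** [eps i] is the scalar by which the degree-zero component of its argument
    acts on [e i]. *)
Lemma exists_vertex_coordinates : exists eps : I -> A -> K,
  [/\ forall i, linear (eps i : A -> K^o),
      forall i x, gr 0 x -> e i ** x = eps i x *: e i,
      forall i x, gr 0 x -> x ** e i = eps i x *: e i
    & forall i h x, gr h x -> h != 0 -> eps i x = 0].
Proof.
have /choice[eps epsE] : forall ix : I * A, exists c : K,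
    e ix.1 ** component gr 0 ix.2 = c *: e ix.1 /\
    component gr 0 ix.2 ** e ix.1 = c *: e ix.1.
  by move=> [i x]; apply: e0; apply: mem_component.
have inj i := family_scale_inj De (i := i).
have comp0 x : gr 0 x -> component gr 0 x = x by apply: component_id.
exists (fun i x => eps (i, x)); split.
- move=> i k x y; apply: (inj i) => /=; have [/= <- _] := epsE (i, k *: x + y).
  rewrite (component_linear dgr) nmulDr -nscaleAr.
  have [/= -> _] := epsE (i, x); have [/= -> _] := epsE (i, y).
  by rewrite scalerDl scalerA.
- by move=> i x /comp0 x0; have [/= <- _] := epsE (i, x); rewrite x0.
- by move=> i x /comp0 x0; have [/= _ <-] := epsE (i, x); rewrite x0.
move=> i h x hx h0; apply: (inj i) => /=; have [/= <- _] := epsE (i, x).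
by rewrite (component_neq dgr hx) 1?eq_sym // nmul0r scale0r.
Qed.

(** The last hypothesis expresses primitivity: if [e k] is the only member with
    [e k ** u != 0], then [u = e k ** u] is a multiple of [e k], and both are
    nonzero idempotents. *)
Lemma degree0_primitive u : gr 0 u -> u ** u = u -> u <> 0 ->
  (forall k l, e k ** u <> 0 -> e l ** u <> 0 -> k = l) -> exists k, u = e k.
Proof.
move=> gu uu u0 uniqk.
have [k ku] : exists k, e k ** u <> 0.
  apply: contrapT => nk; apply: u0; apply: (left_peirce_eq0 De) => k.
  by apply: contrapT => ku; apply: nk; exists k.
exists k; have {1}-> : u = e k ** u.
  apply/eqP; rewrite -subr_eq0; apply/eqP; apply: (left_peirce_eq0 De) => l.
  rewrite nmulDr nmulNr nmulA (family_mul De).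
  case: eqVneq => [->|lk]; first by rewrite subrr.
  rewrite nmul0l subr0; apply: contrapT => lu.
  by rewrite (uniqk _ _ lu ku) eqxx in lk.
have [c [cu _]] := e0 k gu; rewrite cu.
have : c *: (e k ** u) = e k ** u by rewrite nscaleAl -cu -nmulA uu.
move/eqP; rewrite -subr_eq0 -[X in _ - X]scale1r -scalerBl scaler_eq0 subr_eq0.
by case/orP => /eqP // ->; rewrite scale1r.
Qed.

End DegreeZero.

(** * Path algebras and graded presentations *)

Lemma bijective_of_inj_surj (X Y : Type) (f : X -> Y) :
  injective f -> (forall y, exists x, f x = y) -> bijective f.
Proof.
by move=> injf /choice[g fg]; exists g => // x; apply: injf; rewrite fg.
Qed.

Section PathAlgebraGrading.
Context {K : fieldType} {Q : gquiver}.
Local Notation KQ := (path_algebra K Q).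
Implicit Types (p q : qpath Q) (f t : KQ).

Lemma path_ind (P : KQ -> Prop) : P 0 ->
  (forall x y, P x -> P y -> P (x + y)) ->
  (forall k p, P (k *: path_elt K (Some p))) -> forall f, P f.
Proof.
by move=> P0 PD Pp f; rewrite [f]path_algE; elim/big_ind: _ => // p _.
Qed.

Lemma path_coefE p q : mcoeff q (path_elt K (Some p)) = (p == q)%:R.
Proof. by rewrite /= mcoeffU. Qed.

Lemma mcoeff_sum (T : Type) (s : seq T) (F : T -> KQ) p :
  mcoeff p (\sum_(i <- s) F i) = \sum_(i <- s) mcoeff p (F i).
Proof. by apply: (big_morph (mcoeff p)) => [x y|]; rewrite ?mcoeffD ?mcoeff0. Qed.

Lemma path_gradingP h f :
  path_grading K Q h f <-> forall p, pdegree p != h -> mcoeff p f = 0.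
Proof.
split=> [hf p ph|hf p]; first by apply: mcoeff_outdom; apply: contra ph => /hf ->.
by rewrite -mcoeff_neq0 => fp; apply/eqP; apply: contraNT fp => /hf ->.
Qed.

Lemma paths_of_length_geP n f : paths_of_length_ge K Q n f <->
  forall p, (plength p < n)%N -> mcoeff p f = 0.
Proof.
split=> [nf p pn|nf p].
  by apply: mcoeff_outdom; apply/negP => /nf; rewrite leqNgt pn.
by rewrite -mcoeff_neq0 leqNgt => fp; apply: contra fp => /nf ->.
Qed.

Lemma paths_of_length_ge_subspace n : subspace (paths_of_length_ge K Q n).
Proof.
split=> [|k x y /paths_of_length_geP xn /paths_of_length_geP yn];
  apply/paths_of_length_geP => p pn; first exact: mcoeff0.
by rewrite mcoeffD mcoeffZ xn // yn // mulr0 addr0.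
Qed.

Lemma path_elt_degree p : path_grading K Q (pdegree p) (path_elt K (Some p)).
Proof.
apply/path_gradingP => q; rewrite path_coefE.
by have [->|//] := eqVneq p q; rewrite eqxx.
Qed.

(** Homogeneous components are obtained by grouping paths by degree. *)
Lemma path_grading_direct : internal_direct_sum (path_grading K Q).
Proof.
have sg h : subspace (path_grading K Q h).
  split=> [|k x y /path_gradingP xh /path_gradingP yh]; apply/path_gradingP => p.
    by rewrite mcoeff0.
  by move=> ph; rewrite mcoeffD mcoeffZ xh // yh // mulr0 addr0.
split=> // [x|s f us hf f0 h hs].
  pose F h := \sum_(p <- msupp x | h == pdegree p)
    mcoeff p x *: path_elt K (Some p).
  exists (undup [seq pdegree p | p <- msupp x]), F.
    move=> h; apply: subspace_sum => // p _ /eqP ->.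
    exact: subspaceZ _ (sg _) (@path_elt_degree p).
  rewrite [LHS]path_algE /F (exchange_big_dep predT) //=; apply: eq_big_seq => p xp.
  rewrite -big_filter (@filter_pred1_uniq _ _ (pdegree p)) ?undup_uniq ?big_seq1 //.
  by rewrite mem_undup map_f.
apply/malgP => p; rewrite mcoeff0.
have fp k : pdegree p != k -> mcoeff p (f k) = 0.
  by move: p; apply: (path_gradingP k (f k)).1 (hf k).
have [ph|/fp //] := eqVneq (pdegree p) h.
have := congr1 (mcoeff p) f0; rewrite mcoeff_sum mcoeff0 (bigD1_seq h) //=.
rewrite big1 ?addr0 // => h' /negPf hh'.
by apply: fp; rewrite ph eq_sym hh'.
Qed.

Hypothesis degQ : forall a : arrow Q, 0 < adeg a.

Lemma sum_degree_ge (s : seq (arrow Q)) :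
  (size s)%:Z <= \sum_(a <- s) adeg a.
Proof.
elim: s => [|a s IHs]; first by rewrite big_nil.
by rewrite big_cons /= -addn1 PoszD addrC lerD // -gtz0_ge1.
Qed.

(** Integer degrees of arrows being positive, a path of degree zero is
    trivial. *)
Lemma pdegree_ge p : (plength p)%:Z <= pdegree p.
Proof. exact: sum_degree_ge. Qed.

End PathAlgebraGrading.

Section LinearExtension.
Context {K : fieldType} {A : nualgType K} {Q : gquiver}.
Local Notation KQ := (path_algebra K Q).
Implicit Types (p q : qpath Q) (f g : KQ).

Definition linear_extension (w : qpath Q -> A) f : A :=
  \sum_(p <- msupp f) mcoeff p f *: w p.

Lemma linear_extensionEw w (d : {fset qpath Q}) f : (msupp f `<=` d)%fset ->
  linear_extension w f = \sum_(p <- d) mcoeff p f *: w p.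
Proof.
move=> fd; rewrite /linear_extension (big_fset_incl _ fd) //= => p _.
by move/mcoeff_outdom ->; rewrite scale0r.
Qed.

Lemma linear_extension_linear w : linear (linear_extension w).
Proof.
move=> k f g; set d := (msupp f `|` msupp g)%fset.
rewrite !(@linear_extensionEw _ d) ?fsubsetUl ?fsubsetUr //; last first.
  apply: fsubset_trans (msuppD_le _ _) _; apply: fsetSU; exact: msuppZ_le.
rewrite scaler_sumr -big_split; apply: eq_bigr => p _ /=.
by rewrite mcoeffD mcoeffZ scalerDl scalerA.
Qed.

Lemma linear_extension_path w p : linear_extension w (path_elt K (Some p)) = w p.
Proof.
rewrite (@linear_extensionEw _ [fset p]%fset) ?msuppU_le //.
by rewrite big_seq_fset1 path_coefE eqxx scale1r.
Qed.

(** By bilinearity it suffices to compare products of paths. *)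
Lemma linear_extensionM w :
  (forall p q, w p ** w q = linear_extension w (path_elt K (pcat p q))) ->
  {morph linear_extension w : f g / f ** g}.
Proof.
have lw := linear_extension_linear w.
have ext0 : linear_extension w 0 = 0 by apply: lin0.
have extD f g : linear_extension w (f + g) =
  linear_extension w f + linear_extension w g by apply: linD.
have extZ k f : linear_extension w (k *: f) = k *: linear_extension w f.
  exact: linZ.
move=> wM f g; rewrite -[f ** g]/(path_mul f g).
elim/(@path_ind K Q): f => [|f1 f2 IH1 IH2|k p].
- by rewrite path_mul0l ext0 nmul0l.
- by rewrite path_mulDl !extD nmulDl; congr (_ + _).
rewrite -path_scaleAl [in RHS]extZ [LHS]extZ -nscaleAl; congr (_ *: _).
elim/(@path_ind K Q): g => [|g1 g2 IH1 IH2|l q].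
- by rewrite path_mul0r ext0 nmul0r.
- by rewrite path_mulDr !extD nmulDr; congr (_ + _).
rewrite -path_scaleAr [in RHS]extZ [LHS]extZ -nscaleAr; congr (_ *: _).
rewrite path_mulU -wM.
by congr (_ ** _); rewrite [RHS]linear_extension_path.
Qed.

End LinearExtension.

Section Presentations.
Context {K : fieldType} {A : nualgType K} (gr : int -> set A).
Hypothesis grG : is_grading gr.

Let dgr : internal_direct_sum gr. Proof. by case: grG. Qed.

(** A presentation seen from the path algebra: it is handier to work with
    the composite [KQ -> KQ/J -> A] than with the quotient algebra. *)
Definition graded_presentation (Q : gquiver) (psi : path_algebra K Q -> A) :=
  [/\ linear psi, {morph psi : x y / x ** y}, forall a, exists t, psi t = a,
      forall h t, path_grading K Q h t -> gr h (psi t)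
    & forall t, psi t = 0 -> paths_of_length_ge K Q 2 t].

Section Kernel.
Variables (Q : gquiver) (psi : path_algebra K Q -> A).
Hypotheses (psil : linear psi) (psiM : {morph psi : x y / x ** y}).

Definition kernel_ideal : ideal (path_algebra K Q).
Proof.
apply: (@Ideal _ _ [set t | psi t = 0]).
- split=> [|k x y]; first exact: lin0.
  by rewrite /= psil => -> ->; rewrite scaler0 addr0.
- by move=> a x /= x0; rewrite psiM x0 nmul0r.
- by move=> a x /= x0; rewrite psiM x0 nmul0l.
Defined.

End Kernel.

(** A degree-preserving map carries the decomposition of [t] to that of
    [psi t]. *)
Lemma component_map (Q : gquiver) (psi : path_algebra K Q -> A) h t :
  linear psi -> (forall h t, path_grading K Q h t -> gr h (psi t)) ->
  component gr h (psi t) = psi (component (path_grading K Q) h t).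
Proof.
have dQ := @path_grading_direct K Q; move=> psil psid.
apply: (componentE dgr (f := fun k => psi (component (path_grading K Q) k t))).
split=> [k|]; first by apply: psid; apply: mem_component.
have [_ [s [us s0 {2}->]]] := component_decomposition dQ t.
exists s; split=> //; last exact: lin_sum.
by move=> k /s0 ->; apply: lin0.
Qed.

Lemma component_homogeneous (B : nualgType K) (grB : int -> set B) S h t :
  internal_direct_sum grB -> subspace S -> homogeneous_subset grB S ->
  S t -> S (component grB h t).
Proof.
move=> dB sS hS /hS[s [f Sf ->]]; rewrite lin_sum; last exact: component_linear.
apply: subspace_sum => // k _ _; have [fk Sk] := Sf k.
by rewrite (component_in dB _ fk); case: eqP => // _; apply: subspace0.
Qed.

(** The given isomorphism goes from [A] to the quotient, so that the point is
    that its inverse preserves degrees. Lift the components [x_k] of [x = psi t]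
    to homogeneous [u_k]; the element [t - \sum u_k] lies in the homogeneous
    ideal [J], hence so does [u_k] for [k] other than the degree of [t]. *)
Lemma presented_by_presentation Q : presented_by gr Q ->
  exists psi : path_algebra K Q -> A, graded_presentation psi.
Proof.
have dQ := @path_grading_direct K Q.
move=> [_ [J [hJ J2 [F [Fl FM Fb] Fd]]]]; have [G FG GF] := Fb.
have sJ := ideal_subspace J.
pose psi t := G (quotient_proj J t).
have Fpsi t : F (psi t) = quotient_proj J t by rewrite /psi GF.
have psiP t a : F a = quotient_proj J t -> psi t = a by rewrite /psi => <-.
have J0 t : quotient_proj J t = 0 -> ideal_set J t.
  have <- : quotient_proj J 0 = 0 by apply: lin0; apply: quotient_proj_linear.
  by move/quotient_projE; rewrite subr0.
exists psi; split.
- move=> k x y; apply: psiP; rewrite Fl !Fpsi.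
  by rewrite (quotient_proj_linear J).
- by move=> x y; apply: psiP; rewrite FM !Fpsi quotient_projM.
- by move=> a; have [t ta] := quotient_proj_surj (F a); exists t; apply: psiP.
- move=> h t ht.
  have /choice[u uE] : forall k, exists u, path_grading K Q k u /\
      F (component gr k (psi t)) = quotient_proj J u.
    move=> k; have [u ku <-] := Fd _ _ (mem_component dgr k (psi t)).
    by exists u.
  have [s us tE] := component_sum dgr (psi t).
  have Jt : ideal_set J (t - \sum_(k <- s) u k).
    apply/quotient_projE; rewrite -Fpsi tE !lin_sum //; last first.
      exact: quotient_proj_linear.
    by apply: eq_bigr => k _; have [] := uE k.
  rewrite tE; apply: subspace_sum; first exact: grading_subspace.
  move=> k ks _; have [<-|kh] := eqVneq k h; first exact: mem_component.
  suff -> : component gr k (psi t) = 0 by apply: subspace0; apply: grading_subspace.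
  have Juk : ideal_set J (u k).
    rewrite -[u k]opprK; apply: subspaceN => //.
    have := component_homogeneous k dQ sJ hJ Jt.
    rewrite linB; last exact: component_linear.
    rewrite (component_neq dQ ht kh) add0r lin_sum; last exact: component_linear.
    rewrite (bigD1_seq k) //= (component_id dQ) ?big1 ?addr0 //; last first.
      by have [] := uE k.
    move=> l lk; have [lu _] := uE l.
    by rewrite (component_neq dQ lu) // eq_sym.
  apply: (can_inj FG); have [_ ->] := uE k; rewrite (lin0 Fl).
  rewrite -(lin0 (quotient_proj_linear J)); apply/quotient_projE.
  by rewrite subr0.
move=> t t0; apply/J2/J0; rewrite -Fpsi t0; exact: lin0.
Qed.

(** The ideal is the kernel, which is homogeneous as [psi] preserves degrees. *)
Lemma presentation_presented_by Q (psi : path_algebra K Q -> A) :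
  (forall a : arrow Q, 0 < adeg a) -> graded_presentation psi ->
  presented_by gr Q.
Proof.
have dQ := @path_grading_direct K Q.
move=> degQ [psil psiM psis psid psi2]; split=> //.
pose J := kernel_ideal psil psiM; exists J; split.
- move=> t /= t0; have [s _ tE] := component_sum dQ t.
  exists s, ((component (path_grading K Q))^~ t) => // h.
  split; first exact: mem_component.
  rewrite /= -component_map // t0; apply: lin0; exact: component_linear.
- by move=> t /psi2.
have /choice[g gE] := psis.
have projE t t' : quotient_proj J t = quotient_proj J t' <-> psi t = psi t'.
  split=> [/quotient_projE|tt']; [|apply/quotient_projE];
    rewrite /= linB //; last by rewrite tt' subrr.
  by move/eqP; rewrite subr_eq0 => /eqP.
have projl := quotient_proj_linear J.
exists (fun a => quotient_proj J (g a)); first split.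
- by move=> k x y; rewrite -projl; apply/projE; rewrite psil !gE.
- by move=> x y; rewrite -quotient_projM; apply/projE; rewrite psiM !gE.
- apply: bijective_of_inj_surj => [a b /projE|u]; first by rewrite !gE.
  have [t <-] := quotient_proj_surj u; exists (psi t); apply/projE.
  by rewrite gE.
move=> h x hx; exists (component (path_grading K Q) h (g x)).
  exact: mem_component.
by apply/projE; rewrite -component_map // gE component_id.
Qed.

End Presentations.

(** * The canonical quiver of a graded algebra *)

Section ElementaryPaths.
Context {Q : gquiver}.
Implicit Types (p q : qpath Q).

Definition vertex_path (x : vertex Q) : qpath Q := @QPath Q (x, [::]) isT.

Lemma arrow_path_subproof (a : arrow Q) : is_walk (src a) [:: a].
Proof. by rewrite /= eqxx. Qed.

Definition arrow_path (a : arrow Q) : qpath Q :=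
  @QPath Q (src a, [:: a]) (arrow_path_subproof a).

Lemma qpath_eq p q :
  psource p = psource q -> parrows p = parrows q -> p = q.
Proof.
move=> pq1 pq2; apply: val_inj; rewrite /= [qpath_val p]surjective_pairing.
by rewrite [qpath_val q]surjective_pairing; congr (_, _).
Qed.

(** Length zero, one, and at least two; a long path is an arrow followed by a
    nontrivial path, so that its value in [A] is decomposable. *)
Variant qpath_spec : qpath Q -> Prop :=
| VertexPath x : qpath_spec (vertex_path x)
| ArrowPath a : qpath_spec (arrow_path a)
| LongPath a p q of ptarget (arrow_path a) = psource p & (0 < plength p)%N
    & pcat (arrow_path a) p = Some q : qpath_spec q.

Lemma qpath_case p : qpath_spec p.
Proof.
case: p => [[x [|a [|a' s]]] w].
- suff -> : QPath w = vertex_path x by constructor.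
  exact: qpath_eq.
- suff -> : QPath w = arrow_path a by constructor.
  by have /andP[/eqP ax _] := w; apply: qpath_eq => //; apply: esym ax.
have /andP[/eqP ax w'] := w.
pose p := @QPath Q (tgt a, a' :: s) w'.
have [|q ap] := @pcatS Q (arrow_path a) p; first by [].
have [q1 _ q2] := ptarget_pcat ap.
suff -> : QPath w = q by apply: (LongPath _ _ ap).
by apply: qpath_eq; rewrite ?q1 ?q2 //; apply: esym ax.
Qed.

Lemma pdegree_vertex x : pdegree (vertex_path x) = 0.
Proof. by rewrite /pdegree big_nil. Qed.

Lemma pdegree_arrow a : pdegree (arrow_path a) = adeg a.
Proof. by rewrite /pdegree big_seq1. Qed.

Lemma pdegree_pcat p q r : pcat p q = Some r -> pdegree r = pdegree p + pdegree q.
Proof. by move=> /ptarget_pcat[_ _]; rewrite /pdegree => ->; rewrite big_cat. Qed.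

Lemma plength_pcat p q r :
  pcat p q = Some r -> plength r = (plength p + plength q)%N.
Proof. by move=> /ptarget_pcat[_ _]; rewrite /plength => ->; rewrite size_cat. Qed.

Lemma pcat_vertexl x p : pcat (vertex_path x) p =
  if x == psource p then Some p else None.
Proof.
case: eqVneq => [xp|/eqP ne]; last exact: pcatN.
have [r pr] := @pcatS Q (vertex_path x) p xp; rewrite pr; congr Some.
by have [r1 _ r2] := ptarget_pcat pr; apply: qpath_eq; rewrite ?r1 ?r2.
Qed.

Lemma pcat_vertexr x p : pcat p (vertex_path x) =
  if ptarget p == x then Some p else None.
Proof.
case: eqVneq => [xp|/eqP ne]; last exact: pcatN.
have [r pr] := @pcatS Q p (vertex_path x) xp; rewrite pr; congr Some.
by have [r1 _ r2] := ptarget_pcat pr; apply: qpath_eq; rewrite ?r1 ?r2 ?cats0.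
Qed.

Lemma vertex_path_inj : injective vertex_path.
Proof. by move=> x y /(congr1 (@psource Q)). Qed.

Lemma arrow_path_inj : injective arrow_path.
Proof. by move=> x y /(congr1 (@parrows Q)) []. Qed.

End ElementaryPaths.

Section PathValues.
Context {K : fieldType} {A : nualgType K} {Q : gquiver}.
Variables (v : vertex Q -> A) (alpha : arrow Q -> A).
Hypothesis vM : forall x y, v x ** v y = if x == y then v x else 0.
Hypothesis valpha : forall a, v (src a) ** alpha a = alpha a.
Hypothesis alphav : forall a, alpha a ** v (tgt a) = alpha a.

Fixpoint walk_value (x : vertex Q) (s : seq (arrow Q)) : A :=
  if s is a :: s' then alpha a ** walk_value (tgt a) s' else v x.

Definition path_value (p : qpath Q) : A := walk_value (psource p) (parrows p).

Lemma walk_valuel x s : is_walk x s -> v x ** walk_value x s = walk_value x s.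
Proof.
case: s => [|a s] /=; first by rewrite vM eqxx.
by case/andP => /eqP <- _; rewrite nmulA valpha.
Qed.

Lemma walk_valuer x s :
  walk_value x s ** v (last x (map (@tgt Q) s)) = walk_value x s.
Proof.
elim: s x => [|a s IHs] x /=; first by rewrite vM eqxx.
by rewrite -nmulA IHs.
Qed.

(** The trivial walk has an idempotent as value, which the valuation of [t]
    absorbs. *)
Lemma walk_value_cat x s t : is_walk (last x (map (@tgt Q) s)) t ->
  walk_value x (s ++ t) = walk_value x s ** walk_value (last x (map (@tgt Q) s)) t.
Proof.
elim: s x => [|a s IHs] x /= wt; first by rewrite walk_valuel.
by rewrite IHs // nmulA.
Qed.

Lemma path_valueM p q :
  path_value p ** path_value q =
  linear_extension path_value (path_elt K (pcat p q)).
Proof.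
case: (eqVneq (ptarget p) (psource q)) => [pq|npq].
  have [r pqr] := pcatS pq; rewrite pqr linear_extension_path.
  have [r1 _ r2] := ptarget_pcat pqr.
  rewrite /path_value r1 r2 walk_value_cat -/(ptarget p) pq //.
  by case: (q) => [[y t] wt].
rewrite (pcatN (elimN eqP npq)) (lin0 (linear_extension_linear _)).
rewrite /path_value -(walk_valuer (psource p)) -(walk_valuel (x := psource q)).
  rewrite nmulA -(nmulA _ (v _) (v _)) vM -/(ptarget p) (negPf npq).
  by rewrite nmul0r nmul0l.
by case: (q) => [[y t] wt].
Qed.

Lemma path_value_degree (gr : int -> set A) p : is_grading gr ->
  (forall x, gr 0 (v x)) -> (forall a, gr (adeg a) (alpha a)) ->
  gr (pdegree p) (path_value p).
Proof.
move=> [_ grM] v0 adega; rewrite /path_value /pdegree.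
elim: (parrows p) (psource p) => [|a s IHs] x; first by rewrite big_nil; apply: v0.
by rewrite big_cons; apply: grM.
Qed.

Lemma path_value_arrow a : path_value (arrow_path a) = alpha a.
Proof. exact: alphav. Qed.

End PathValues.

Section CanonicalQuiver.
Context {I : choiceType} (dim : I * I * nat -> nat).

(** In [(i, j, m, k)] the index [m] is the degree minus one, so that degrees
    are positive by construction, and [k] numbers the [dim (i, j, m)] arrows
    from [i] to [j] of that degree. *)
Definition canonical_quiver : gquiver := @GQuiver I
  {x : I * I * nat * nat | (x.2 < dim x.1)%N}
  (fun a => (val a).1.1.1) (fun a => (val a).1.1.2)
  (fun a => (val a).1.2.+1%:Z).

End CanonicalQuiver.

Section CanonicalPresentation.
Context {K : fieldType} {A : nualgType K} (gr : int -> set A).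
Context {I : choiceType} (e : I -> A).
Hypothesis grG : is_grading gr.
Hypothesis pos : forall h : int, h < 0 -> gr h = [set 0].
Hypothesis De : distinguished_family gr e.
Hypothesis e0 : forall i x, gr 0 x ->
  exists c, e i ** x = c *: e i /\ x ** e i = c *: e i.
Variables (dim : I * I * nat -> nat) (b : I * I * nat -> nat -> A)
  (c : I * I * nat -> nat -> A -> K).
Hypothesis bc : forall x : I * I * nat,
  arrow_coordinates gr e x.1.1 x.1.2 x.2.+1%:Z (dim x) (b x) (c x).

Let dgr : internal_direct_sum gr. Proof. by case: grG. Qed.

Local Notation Q := (canonical_quiver dim).

Let alpha (a : arrow Q) : A := b (val a).1 (val a).2.

Let alphaE (a : arrow Q) : gr (adeg a) (alpha a) /\
  e (src a) ** alpha a ** e (tgt a) = alpha a.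
Proof.
have [Vb _ _ _ _] := bc (val a).1.
exact: (corner_gradedE grG De _ _ _ _).1 (Vb (val a).2).
Qed.

Let alphal (a : arrow Q) : e (src a) ** alpha a = alpha a.
Proof.
by have [_ <-] := alphaE a; rewrite !nmulA (family_idem De).
Qed.

Let alphar (a : arrow Q) : alpha a ** e (tgt a) = alpha a.
Proof.
by have [_ <-] := alphaE a; rewrite -!nmulA (family_idem De).
Qed.

Definition canonical_map : path_algebra K Q -> A :=
  linear_extension (path_value (Q := Q) e alpha).

Let lin : linear canonical_map. Proof. exact: linear_extension_linear. Qed.

Let mapM : {morph canonical_map : x y / x ** y}.
Proof.
apply: linear_extensionM; by apply: path_valueM => //; apply: (family_mul De).
Qed.

Let mapE p : canonical_map (path_elt K (Some p)) = path_value (Q := Q) e alpha p.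
Proof. exact: linear_extension_path. Qed.

Let value_degree p : gr (pdegree p) (path_value (Q := Q) e alpha p).
Proof.
apply: path_value_degree => // [x|a]; first exact: (family_degree0 De).
by have [] := alphaE a.
Qed.

Lemma canonical_map_degree h t :
  path_grading K Q h t -> gr h (canonical_map t).
Proof.
move=> ht; apply: subspace_sum => [|p /ht <- _]; first exact: grading_subspace.
by apply: subspaceZ => //; apply: grading_subspace.
Qed.

Let image_subspace : subspace (range canonical_map).
Proof.
split=> [|k _ _ [x _ <-] [y _ <-]]; first by exists 0 => //; apply: lin0.
by exists (k *: x + y) => //; rewrite lin.
Qed.

(** Modulo decomposable elements, every element of positive degree is a
    combination of arrows; decomposables are handled by induction. *)
Lemma canonical_map_surj_nat (n : nat) x : gr n%:Z x -> range canonical_map x.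
Proof.
elim/ltn_ind: n x => n IHn x nx.
have sI := image_subspace.
apply: (peirce_ind De) => [|y z|i j].
- exact: subspace0.
- exact: subspaceD.
case: n IHn nx => [_ x0|m IHm xm].
  have [r [ex _]] := e0 i x0; rewrite ex -nscaleAl (family_mul De).
  apply: subspaceZ => //; case: eqP => _; last exact: subspace0.
  by exists (path_elt K (Some (vertex_path (Q := Q) i))); rewrite // mapE.
have [_ _ _ _ [_ bx]] := bc (i, j, m).
have {bx} := bx (e i ** x ** e j); set y := e i ** x ** e j => /(_ _)[].
  by exists x.
move=> s Ns ys; rewrite -[y](subrK (\sum_(k < dim (i, j, m))
  c (i, j, m) k y *: b (i, j, m) k)); apply: subspaceD => //.
  rewrite ys; apply: subspace_sum => // z /Ns[p [q [u [w [p0 q0 pq up [wq ->]]]]]] _.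
  have Im r t : 0 < r -> r < m.+1%:Z -> gr r t -> range canonical_map t.
    by case: r => [r|//] _ rm; apply: IHm.
  have [u' _ <-] : range canonical_map u by apply: (Im p); rewrite // -pq ltrDl.
  have [w' _ <-] : range canonical_map w by apply: (Im q); rewrite // -pq ltrDr.
  by exists (u' ** w').
apply: subspace_sum => // k _ _; apply: subspaceZ => //.
pose a : arrow Q := exist _ (i, j, m, val k) (ltn_ord k).
exists (path_elt K (Some (arrow_path a))) => //.
by rewrite mapE path_value_arrow.
Qed.

(** Negative degrees contain only zero. *)
Lemma canonical_map_surj x : exists t, canonical_map t = x.
Proof.
have sI := image_subspace.
suff [t _ <-] : range canonical_map x by exists t.
elim/(grading_ind grG): x => [|x y|[n|n] x].
- exact: subspace0.
- exact: subspaceD.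
- exact: canonical_map_surj_nat.
by rewrite pos // => ->; apply: subspace0.
Qed.

(** Both sides are linear in [t] and agree on paths. *)
Let dual_coef p (l : A -> K) : linear (l : A -> K^o) ->
  (forall q, l (path_value (Q := Q) e alpha q) = (q == p)%:R) ->
  forall t, l (canonical_map t) = mcoeff p t.
Proof.
move=> ll lp t; rewrite {2}[t]path_algE mcoeff_sum.
rewrite /canonical_map /linear_extension [LHS](lin_sum _ _ _ ll).
apply: eq_bigr => q _; rewrite [LHS](linZ _ _ ll) mcoeffZ lp path_coefE.
by [].
Qed.

(** The coefficients of [t] at a vertex and at an arrow are values at
    [canonical_map t] of the coordinate functionals of [A]. *)
Lemma canonical_map_kernel t :
  canonical_map t = 0 -> paths_of_length_ge K Q 2 t.
Proof.
move=> t0; apply/paths_of_length_geP => p; case: (qpath_case p) => [x _|a _|].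
- have [eps [epsl epse _ eps0]] := exists_vertex_coordinates grG De e0.
  rewrite -(dual_coef (epsl x)) ?t0 ?(lin0 (epsl x)) // => q.
  have [q0|q0] := eqVneq (pdegree q) 0; last first.
    rewrite (eps0 _ _ _ (value_degree q)) //; case: eqVneq => // qx.
    by rewrite qx pdegree_vertex eqxx in q0.
  have [y ->] : exists y, q = vertex_path y.
    have := @pdegree_ge Q (fun=> isT) q; rewrite q0.
    by case: (qpath_case q) => [y _|//|a p' r _ _ /plength_pcat->//]; exists y.
  rewrite (inj_eq vertex_path_inj); apply: (family_scale_inj De (i := x)).
  rewrite -epse; last exact: (family_degree0 De).
  by rewrite (family_mul De) eq_sym; case: eqP; rewrite ?scale1r ?scale0r.
- case: a => -[ijm k] kn; set a : arrow Q := exist _ _ _.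
  have [Vb cl cb cN [cpi _]] := bc ijm; set h := _.+1%:Z in Vb cN cpi.
  rewrite -(dual_coef (cl k)) ?t0 ?(lin0 (cl k)) // => q.
  have c0 x : component gr h x = 0 -> c ijm k x = 0.
    by move=> x0; rewrite cpi x0 nmul0r nmul0l (lin0 (cl k)).
  have ch g x : gr g x -> g != h -> c ijm k x = 0.
    by move=> gx gh; apply: c0; apply: (component_neq dgr gx); rewrite eq_sym.
  have qd := value_degree q.
  have [qh|qh] := eqVneq (pdegree q) h; last first.
    rewrite (ch _ _ qd qh); case: eqVneq => // qa.
    by rewrite qa pdegree_arrow eqxx in qh.
  move: qd; rewrite qh.
  case: (qpath_case q) qh => [y|a' a'h a'd|a' p' q' _ p'0 q'E q'h].
  + by rewrite pdegree_vertex.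
  + rewrite (inj_eq arrow_path_inj) path_value_arrow //.
    rewrite pdegree_arrow in a'h.
    case: a' a'h a'd => -[ijm' k'] k'n; have [ijmE|ne] := eqVneq ijm' ijm.
      subst ijm' => _ _; rewrite -val_eqE /= xpair_eqE eqxx /alpha /=.
      by rewrite cb // eq_sym.
    set a' : arrow Q := exist _ _ _ => a'h a'd.
    rewrite -val_eqE /= xpair_eqE (negPf ne) /=.
    rewrite cpi (component_id dgr); last by rewrite path_value_arrow in a'd.
    have [_ <-] := alphaE a'; rewrite !nmulA (family_mul De) /=.
    case: eqVneq => [iE|_]; last by rewrite !nmul0l (lin0 (cl k)).
    rewrite -!nmulA (family_mul De); case: eqVneq => [jE|_]; last first.
      by rewrite !nmul0r (lin0 (cl k)).
    have triple (x y : I * I * nat) :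
        x.1.1 = y.1.1 -> x.1.2 = y.1.2 -> x.2 = y.2 -> x = y.
      by case: x y => [[? ?] ?] [[? ?] ?] /= -> -> ->.
    by case/eqP: ne; apply: triple => //; case: a'h.
  have -> : (q' == arrow_path a) = false.
    apply/negP => /eqP qa; have := plength_pcat q'E; rewrite qa => -[].
    by rewrite add0n; case: plength p'0.
  move=> _; apply: cN => //; rewrite -q'h (pdegree_pcat q'E).
  have -> : path_value (Q := Q) e alpha q' =
      path_value (Q := Q) e alpha (arrow_path a') ** path_value (Q := Q) e alpha p'.
    rewrite -!mapE -mapM; congr canonical_map.
    by rewrite -[RHS]/(path_mul _ _) path_mulU q'E.
  apply: decomposable_mul => //; first by rewrite pdegree_arrow.
  by apply: lt_le_trans (@pdegree_ge Q (fun=> isT) p').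
- by move=> a p' q _ p'0 /plength_pcat ->; rewrite ltnNge ltnS p'0.
Qed.

Lemma canonical_presentation : graded_presentation gr canonical_map.
Proof.
split=> //; first exact: canonical_map_surj.
- exact: canonical_map_degree.
- exact: canonical_map_kernel.
Qed.

Lemma canonical_presented_by : presented_by gr Q.
Proof. exact: presentation_presented_by canonical_presentation. Qed.

End CanonicalPresentation.

(** * Uniqueness of the quiver *)

Section Uniqueness.
Context {K : fieldType} {A : nualgType K} (gr : int -> set A).
Context {I : choiceType} (e : I -> A).
Hypothesis grG : is_grading gr.
Hypothesis De : distinguished_family gr e.
Hypothesis e0 : forall i x, gr 0 x ->
  exists c, e i ** x = c *: e i /\ x ** e i = c *: e i.

Let dgr : internal_direct_sum gr. Proof. by case: grG. Qed.

Section Presentation.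
Variables (Q : gquiver) (psi : path_algebra K Q -> A).
Hypothesis degQ : forall a : arrow Q, 0 < adeg a.
Hypothesis psiP : graded_presentation gr psi.
Implicit Types (p q : qpath Q) (a : arrow Q).

Local Notation vertex_value x := (psi (path_elt K (Some (vertex_path x)))).
Local Notation arrow_value a := (psi (path_elt K (Some (arrow_path a)))).

Let dQ := @path_grading_direct K Q.
Let lin : linear psi. Proof. by case: psiP. Qed.
Let psiM : {morph psi : x y / x ** y}. Proof. by case: psiP. Qed.
Let surj x : exists t, psi t = x. Proof. by case: psiP. Qed.
Let psid h t : path_grading K Q h t -> gr h (psi t).
Proof. by case: psiP => _ _ _ + _; apply. Qed.
Let psi2 t : psi t = 0 -> paths_of_length_ge K Q 2 t.
Proof. by case: psiP => _ _ _ _; apply. Qed.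

Let psi_path p q : psi (path_elt K (Some p)) ** psi (path_elt K (Some q)) =
  psi (path_elt K (pcat p q)).
Proof.
rewrite -psiM; congr psi; exact: path_mulU.
Qed.

Let psi_degree p : gr (pdegree p) (psi (path_elt K (Some p))).
Proof. exact: (psid (@path_elt_degree K Q p)). Qed.

Let homogeneous_lift h x : gr h x -> exists2 t, path_grading K Q h t & psi t = x.
Proof.
move=> hx; have [t tx] := surj x; exists (component (path_grading K Q) h t).
  exact: mem_component.
by rewrite -(component_map grG) // tx component_id.
Qed.

Let psi_sum t : psi t =
  \sum_(p <- msupp t) mcoeff p t *: psi (path_elt K (Some p)).
Proof.
rewrite {1}[t]path_algE (lin_sum _ _ _ lin).
by apply: eq_bigr => p _; rewrite (linZ _ _ lin).
Qed.

Lemma vertex_value_mul x y : vertex_value x ** vertex_value y =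
  if x == y then vertex_value x else 0.
Proof.
rewrite psi_path pcat_vertexl; case: eqVneq => [->//|_].
exact: lin0.
Qed.

Lemma vertex_value_neq0 x : vertex_value x <> 0.
Proof.
move=> /psi2 /paths_of_length_geP /(_ (vertex_path x) isT).
by rewrite path_coefE eqxx => /eqP; rewrite oner_eq0.
Qed.

Let degree0_path p : pdegree p = 0 -> exists x, p = vertex_path x.
Proof.
have := pdegree_ge degQ p => + p0; rewrite p0.
by case: (qpath_case p) => [y _|//|a p' r _ _ /plength_pcat->//]; exists y.
Qed.

(** [gr 0] is spanned by the images of the vertices, so it acts on each of
    them by scalars; two different [e k], [e l] acting nontrivially on the same
    image would contradict [e l ** e k = 0]. *)
Lemma vertex_value_family x : exists i, vertex_value x = e i.
Proof.
have u0 : gr 0 (vertex_value x).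
  by have := psi_degree (vertex_path x); rewrite pdegree_vertex.
have uu : vertex_value x ** vertex_value x = vertex_value x.
  by rewrite vertex_value_mul eqxx.
apply: (degree0_primitive De e0 u0 uu (@vertex_value_neq0 x)).
have mulu k : exists c, e k ** vertex_value x = c *: vertex_value x.
  have [t t0 <-] := homogeneous_lift (family_degree0 De k).
  rewrite psi_sum nmul_suml.
  elim/big_ind: _ => [|y z [a ->] [b ->]|p _].
  - by exists 0; rewrite scale0r.
  - by exists (a + b); rewrite scalerDl.
  have [->|pt] := eqVneq (mcoeff p t) 0.
    by exists 0; rewrite [RHS]scale0r scale0r nmul0l.
  rewrite mcoeff_neq0 in pt.
  have [y ->] := degree0_path (t0 _ pt).
  rewrite -nscaleAl vertex_value_mul; case: eqVneq => [->|_]; first by eexists.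
  by exists 0; rewrite scaler0 scale0r.
move=> k l ku lu; apply/eqP; rewrite eq_sym; case: eqVneq => // lk; case: lu.
have [c cu] := mulu k.
have c0 : c != 0 by apply/eqP => c0; rewrite cu c0 scale0r in ku.
have := congr1 (nmul (e l)) cu.
rewrite nmulA (family_mul De) (negPf lk) nmul0l -nscaleAr.
by move/esym/eqP; rewrite scaler_eq0 (negPf c0) => /eqP.
Qed.

Lemma exists_vertex_bijection :
  exists2 sigma : vertex Q -> I, bijective sigma
    & forall x, vertex_value x = e (sigma x).
Proof.
have /choice[sigma sE] := vertex_value_family; exists sigma => //.
apply: bijective_of_inj_surj => [x y xy|k].
  apply/eqP; case: eqVneq => // ne; have := vertex_value_mul x y.
  rewrite (negPf ne) [in X in _ ** X = _ -> _]sE -xy -sE.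
  by rewrite vertex_value_mul eqxx => /vertex_value_neq0.
apply: contrapT => nk; apply: (family_neq0 De (i := k)).
rewrite -(family_idem De).
have [t t0 tk] := homogeneous_lift (family_degree0 De k).
rewrite -{2}tk psi_sum nmul_sumr big_seq big1 // => p pt.
have [x ->] := degree0_path (t0 _ pt).
rewrite -nscaleAr sE (family_mul De); case: eqVneq => [kx|_].
  by case: nk; exists x.
exact: scaler0.
Qed.

Section ArrowEnumeration.
Variable sigma : vertex Q -> I.
Hypothesis sE : forall x, vertex_value x = e (sigma x).
Variables (i j : I) (h : int) (n : nat) (b : nat -> A) (c : nat -> A -> K).
Hypothesis h0 : 0 < h.
Hypothesis bc : arrow_coordinates gr e i j h n b c.

Let N := decomposable gr h.
Let sN : subspace N. Proof. exact: decomposable_subspace. Qed.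

Let between (a : arrow Q) : bool :=
  [&& sigma (src a) == i, sigma (tgt a) == j & adeg a == h].

Let value_source p : e (sigma (psource p)) ** psi (path_elt K (Some p)) =
  psi (path_elt K (Some p)).
Proof. by rewrite -sE psi_path pcat_vertexl eqxx. Qed.

Let value_target p : psi (path_elt K (Some p)) ** e (sigma (ptarget p)) =
  psi (path_elt K (Some p)).
Proof. by rewrite -sE psi_path pcat_vertexr eqxx. Qed.

Let arrow_value_corner a : between a -> corner (e i) (e j) (gr h) (arrow_value a).
Proof.
move=> /and3P[/eqP ai /eqP aj /eqP ah]; apply/(corner_gradedE grG De); split.
  by rewrite -ah -pdegree_arrow.
have := value_source (arrow_path a); rewrite /psource /= ai => ->.
by have := value_target (arrow_path a); rewrite /ptarget /= aj.
Qed.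

Let positive_length g t : 0 < g -> path_grading K Q g t -> paths_of_length_ge K Q 1 t.
Proof.
move=> g0 gt p /gt pg; rewrite lt0n; apply/eqP => p0.
suff : pdegree p = 0 by rewrite pg => gE; rewrite gE in g0.
move: p0 {pg}; case: (qpath_case p) => [x _|//|a p' r _ _ /plength_pcat->//].
exact: pdegree_vertex.
Qed.

Let length_mul s t : paths_of_length_ge K Q 1 s -> paths_of_length_ge K Q 1 t ->
  paths_of_length_ge K Q 2 (s ** t).
Proof.
have s2 := @paths_of_length_ge_subspace K Q 2.
move=> s1 t1; rewrite path_algebra_mulE; apply: subspace_sum => // p /s1 p1 _.
apply: subspace_sum => // q /t1 q1 _; apply: (subspaceZ _ s2).
case pq : (pcat p q) => [r|]; last exact: subspace0.
apply/paths_of_length_geP => r' r'2; rewrite path_coefE.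
case: eqVneq => // rr'; rewrite -rr' (plength_pcat pq) in r'2.
by move: r'2; rewrite ltnNge (leq_add p1 q1).
Qed.

(** A homogeneous element of positive degree lifts to a combination of
    nontrivial paths. *)
Let decomposable_lift x : N x -> exists2 t, paths_of_length_ge K Q 2 t & psi t = x.
Proof.
have s2 := @paths_of_length_ge_subspace K Q 2.
pose V := [set psi t | t in paths_of_length_ge K Q 2].
suff NV : N `<=` V by move=> /NV[t]; exists t.
apply: finite_sums_sub => [|_ [p [q [s [t [p0 q0 _ ps [qt ->]]]]]]].
  split=> [|k _ _ [s s2' <-] [t t2 <-]].
    by exists 0; [apply: subspace0 | apply: lin0].
  exists (k *: s + t); last exact: lin.
  by case: s2 => _; apply.
have [s' ps' <-] := homogeneous_lift ps; have [t' qt' <-] := homogeneous_lift qt.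
exists (s' ** t'); last exact: psiM.
exact: (length_mul (positive_length p0 ps') (positive_length q0 qt')).
Qed.

Let arrow_values (s : seq (arrow Q)) k : A := nth 0 [seq arrow_value a | a <- s] k.

(** Lift a decomposable combination of arrows to a combination of paths of
    length at least two: the difference is in the kernel, hence also of length
    at least two, and the coefficients of the arrows vanish. *)
Let arrow_values_free s : uniq s -> free_modulo N (size s) (arrow_values s).
Proof.
move=> us r Nr k ks.
have [a0 _] : exists a0 : arrow Q, True by case: (s) ks => [//|a0]; exists a0.
pose t : path_algebra K Q :=
  \sum_(l < size s) r l *: path_elt K (Some (arrow_path (nth a0 s l))).
have tE : psi t = \sum_(l < size s) r l *: arrow_values s l.
  rewrite /t (lin_sum _ _ _ lin); apply: eq_bigr => l _.
  by rewrite (linZ _ _ lin) /arrow_values (nth_map a0).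
have [z z2 zt] := decomposable_lift Nr.
have s2 := @paths_of_length_ge_subspace K Q 2.
have /paths_of_length_geP/(_ (arrow_path (nth a0 s k)) isT) :
    paths_of_length_ge K Q 2 t.
  rewrite -[t](subrK z); apply: (subspaceD s2 _ z2); apply: psi2.
  by rewrite (linB _ _ lin) tE zt subrr.
rewrite /t mcoeff_sum (bigD1 (Ordinal ks)) //= big1 => [|l lk].
  by rewrite addr0 mcoeffZ mcoeffUU mulr1.
rewrite mcoeffZ mcoeffU (inj_eq arrow_path_inj) nth_uniq //.
by rewrite -[_ == _]/(l == Ordinal ks) (negPf lk) mulr0.
Qed.

(** Modulo decomposables only paths of length one survive, and among these
    only the arrows from [i] to [j] of degree [h]. *)
Let arrow_values_span s : (forall a, between a -> a \in s) ->
  forall x, corner (e i) (e j) (gr h) x -> spanned_modulo N (size s) (arrow_values s) x.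
Proof.
move=> sP x /(corner_gradedE grG De)[hx xE].
have sS : subspace (spanned_modulo N (size s) (arrow_values s)).
  split=> [|k y z [ry Ny] [rz Nz]].
    exists (fun=> 0); rewrite big1 ?subrr => [|l _]; last exact: scale0r.
    exact: subspace0.
  exists (fun l => k * ry l + rz l).
  have := subspaceD sN (subspaceZ k sN Ny) Nz.
  rewrite scalerBr scaler_sumr addrACA -opprD -big_split /=.
  congr (N (_ - _)); apply: eq_bigr => l _.
  by rewrite scalerDl scalerA.
have NS y : N y -> spanned_modulo N (size s) (arrow_values s) y.
  by exists (fun=> 0); rewrite big1 ?subr0 // => l _; rewrite scale0r.
have [t ht tx] := homogeneous_lift hx; rewrite -xE -tx psi_sum nmul_sumr nmul_suml.
apply: subspace_sum => // p pt _; rewrite -nscaleAr -nscaleAl; apply: subspaceZ => //.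
move: (ht _ pt); case: (qpath_case p) => [y|a|a p' q _ p'0 q'E].
- by rewrite pdegree_vertex => hE; move: h0; rewrite -hE.
- rewrite pdegree_arrow => ah.
  have [ab|nab] := boolP (between a).
    have [_ ->] := (corner_gradedE grG De _ _ _ _).1 (arrow_value_corner ab).
    have as' := sP _ ab; exists (fun l => (l == index a s)%:R).
    have is' : (index a s < size s)%N by rewrite index_mem.
    rewrite (bigD1 (Ordinal is')) //= eqxx scale1r big1 ?addr0 => [|l ls].
      by rewrite /arrow_values (nth_map a) // nth_index // subrr; apply: subspace0.
    by rewrite -[_ == _]/(l == Ordinal is') (negPf ls) scale0r.
  rewrite -(value_source (arrow_path a)) -(value_target (arrow_path a)).
  rewrite !nmulA (family_mul De) -!nmulA (family_mul De).
  rewrite -[psource _]/(src a) -[ptarget _]/(tgt a).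
  move: nab; rewrite /between ah eqxx andbT negb_and.
  rewrite [sigma (src a) == i]eq_sym => /orP[/negPf ni|/negPf nj].
    by rewrite ni nmul0l; apply: subspace0.
  by rewrite nj !nmul0r; apply: subspace0.
rewrite (pdegree_pcat q'E) => hE; apply: NS; rewrite -q'E -psi_path.
apply: decomposable_peirce => //; rewrite /N -hE.
apply: decomposable_mul => //; first by rewrite pdegree_arrow.
by apply: lt_le_trans (pdegree_ge degQ p').
Qed.

(** The images of these arrows are free modulo decomposables, as a relation
    would lift to an element of the kernel containing a path of length one;
    hence there are at most [n]. They also span, as every longer path is
    decomposable; hence there are exactly [n]. *)
Lemma arrow_enumeration : exists s : seq (arrow Q), [/\ uniq s, size s = n
  & forall a, (a \in s) =
      [&& sigma (src a) == i, sigma (tgt a) == j & adeg a == h]].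
Proof.
have [Vb cl cb cN [_ bx]] := bc.
have bound s : uniq s -> all between s -> (size s <= n)%N.
  move=> us /allP sb; apply: (free_modulo_leq sN (arrow_values_free us)) => k ks.
  exists (c^~ (arrow_values s k)); apply: bx.
  have [a0 _] : exists a0 : arrow Q, True by case: (s) ks => [//|a0]; exists a0.
  rewrite /arrow_values (nth_map a0) //; apply: arrow_value_corner.
  exact/sb/mem_nth.
pose P m := `[< exists s, [/\ uniq s, all between s & size s = m] >].
have P0 : exists m, P m by exists 0%N; apply/asboolP; exists [::].
have Pm m : P m -> (m <= n)%N by move=> /asboolP[s [us sb <-]]; apply: bound.
(* A longest list of distinct such arrows contains all of them. *)
case: (ex_maxnP P0 Pm) => m /asboolP[s [us sb sm]] maxm.
have sP a : between a -> a \in s.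
  move=> ab; apply: contraT => nas; suff /maxm : P m.+1 by rewrite ltnn.
  by apply/asboolP; exists (a :: s); split; rewrite /= ?nas ?ab // sm.
exists s; split=> // [|a]; last first.
  by apply/idP/idP => [/(allP sb)|/sP].
apply/eqP; rewrite eqn_leq bound //=.
have fb : free_modulo N n b.
  move=> r Nr k kn; have := cN k _ kn Nr.
  rewrite [LHS](lin_sum _ _ _ (cl k)) (bigD1 (Ordinal kn)) //= big1 => [|l lk].
    by rewrite addr0 [LHS](linZ _ _ (cl k)) cb // eqxx; rewrite [LHS]mulr1.
  rewrite [LHS](linZ _ _ (cl k)) cb // eq_sym -[_ == _]/(l == Ordinal kn).
  by rewrite (negPf lk) scaler0.
by apply: (free_modulo_leq sN fb) => k _; apply: arrow_values_span.
Qed.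

End ArrowEnumeration.
End Presentation.

Variables (dim : I * I * nat -> nat) (b : I * I * nat -> nat -> A)
  (c : I * I * nat -> nat -> A -> K).
Hypothesis bc : forall x : I * I * nat,
  arrow_coordinates gr e x.1.1 x.1.2 x.2.+1%:Z (dim x) (b x) (c x).

(** Both quivers have as many arrows between given vertices in a given
    degree: match the [k]-th arrow of the canonical quiver with the [k]-th
    entry of an enumeration. *)
Lemma presented_by_canonical Q : presented_by gr Q ->
  gquiver_iso (canonical_quiver dim) Q.
Proof.
move=> pQ; have [degQ _] := pQ.
have [psi psiP] := presented_by_presentation grG pQ.
have [sigma [tau sK tK] sE] := exists_vertex_bijection degQ psiP.
have /choice[L LP] : forall x : I * I * nat, exists s : seq (arrow Q),
    [/\ uniq s, size s = dim x & forall a, (a \in s) =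
      [&& sigma (src a) == x.1.1, sigma (tgt a) == x.1.2
        & adeg a == x.2.+1%:Z]].
  by move=> x; apply: (arrow_enumeration degQ psiP sE _ (bc x)).
have /choice[f fP] : forall a : arrow (canonical_quiver dim), exists a',
    a' \in L (val a).1 /\ index a' (L (val a).1) = (val a).2.
  case=> -[x k] /= kn; have [us sn _] := LP x; rewrite -sn in kn.
  have [a0 _] : exists a0 : arrow Q, True by case: (L x) kn => [//|a0]; exists a0.
  by exists (nth a0 (L x) k); rewrite mem_nth // index_uniq.
have fE a : [/\ sigma (src (f a)) = src a, sigma (tgt (f a)) = tgt a
    & adeg (f a) = adeg a].
  have [+ _] := fP a; have [_ _ ->] := LP (val a).1.
  by move=> /and3P[/eqP ? /eqP ? /eqP ?].
exists tau, f; split.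
- by exists sigma.
- apply: bijective_of_inj_surj => [a a' aa'|a'].
    have [s1 t1 d1] := fE a; have [s2 t2 d2] := fE a'.
    rewrite aa' s2 in s1; rewrite aa' t2 in t1; rewrite aa' d2 in d1.
    have [_ i1] := fP a; have [_ i2] := fP a'.
    have E : (val a).1 = (val a').1.
      case: a a' s1 t1 d1 {aa' s2 t2 d2 i1 i2}
        => [[[[? ?] ?] ?] ?] [[[[? ?] ?] ?] ?] /=.
      by move=> -> -> [->].
    apply: val_inj; rewrite [val a]surjective_pairing [val a']surjective_pairing.
    by rewrite -i1 -i2 E aa'.
  have : 0 < adeg a' by [].
  case dE : (adeg a') => [[//|m]|//] _.
  (* The canonical arrow whose index is the position of [a'] in its list. *)
  pose x := (sigma (src a'), sigma (tgt a'), m).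
  have a'L : a' \in L x by have [_ _ ->] := LP x; rewrite /= !eqxx dE eqxx.
  have kn : (index a' (L x) < dim x)%N.
    by have [_ <- _] := LP x; rewrite index_mem.
  pose a : arrow (canonical_quiver dim) := exist _ (x, index a' (L x)) kn.
  exists a; have [aL ai] := fP a.
  by rewrite -(nth_index a' aL) ai nth_index.
- by move=> a; have [<- _ _] := fE a; rewrite sK.
- by move=> a; have [_ <- _] := fE a; rewrite sK.
- by move=> a; have [_ _ ->] := fE a.
Qed.

End Uniqueness.

(** * Nakayama forms *)

Section NakayamaForms.
Context {K : fieldType} {A : nualgType K} (gr : int -> set A).
Context {I : choiceType} (e : I -> A).
Hypothesis grG : is_grading gr.
Hypothesis De : distinguished_family gr e.
Variables (B : A -> A -> K) (nu : I -> I) (d : I -> int).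
Hypothesis data : nakayama_form_data gr e B nu d.

Local Notation comp := (component gr).
Let dgr : internal_direct_sum gr. Proof. by case: grG. Qed.

Let linl y : linear (B^~ y : A -> K^o).
Proof. by move=> k x x'; case: data => -[-> _]. Qed.
Let linr x : linear (B x : A -> K^o).
Proof. by move=> k y y'; case: data => -[_ ->]. Qed.
Let formA a b c : B (a ** b) c = B a (b ** c).
Proof. by case: data. Qed.
Let nu_bij : bijective nu. Proof. by case: data. Qed.
Let form0 x i y j : j <> nu i -> B (e i ** x) (y ** e j) = 0.
Proof.
move=> ji; apply/eqP; apply: contra_notT ji => B0.
have [_ _ _ <- _] := data.
by exists (e i ** x), (y ** e j); split; [exists x|exists y|].
Qed.

(** By orthogonality, [(e_i a, -)] sees only the part of its argument that
    ends in [e_(nu i)]. *)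
Let form_eqr i a x y : x ** e (nu i) = y ** e (nu i) ->
  B (e i ** a) x = B (e i ** a) y.
Proof.
move=> xy; apply/eqP; rewrite -subr_eq0; apply/eqP.
rewrite -[LHS](linB _ _ (linr _)).
have [s _ ->] := right_peirce_sum De (x - y).
rewrite [LHS](lin_sum _ _ _ (linr _)) big1 // => k _.
have [->|/eqP] := eqVneq k (nu i); last exact: form0.
by rewrite nmulDl nmulNl xy subrr; apply: (lin0 (linr _)).
Qed.

(** By orthogonality and injectivity of [nu], [(-, a e_(nu j))] sees only
    the part of its argument that starts in [e_j]. *)
Let form_eql j a x y : e j ** x = e j ** y ->
  B x (a ** e (nu j)) = B y (a ** e (nu j)).
Proof.
move=> xy; apply/eqP; rewrite -subr_eq0; apply/eqP.
rewrite -[LHS](linB _ _ (linl _)).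
have [s _ ->] := left_peirce_sum De (x - y).
rewrite [LHS](lin_sum _ _ _ (linl _)) big1 // => k _.
have [->|/eqP kj] := eqVneq k j.
  by rewrite nmulDr nmulNr xy subrr; apply: (lin0 (linl _)).
by apply: form0 => /(bij_inj nu_bij)/esym.
Qed.

Let idem i : e i ** e i = e i. Proof. exact: (family_idem De). Qed.

(** Only the middle Peirce component of the second argument matters. *)
Let form_corner i j a x :
  B (e i ** a ** e j) x = B (e i ** a ** e j) (e j ** x ** e (nu i)).
Proof.
rewrite -(nmulA (e j)) -formA -(nmulA (e i ** a)) idem -(nmulA (e i)).
by apply: form_eqr; rewrite -nmulA idem.
Qed.

Let cornerT i j x : corner (e i) (e j) setT (e i ** x ** e j).
Proof. by exists x. Qed.

Let nondeg i j : nondegenerate_form gr B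
  (corner (e i) (e j) setT) (corner (e j) (e (nu i)) setT).
Proof. by case: data => _ _ _ _ /(_ i j)[]. Qed.

Let dual0 V : in_graded_dual gr V (fun=> 0).
Proof. by split=> [k x y _ _|]; [rewrite mulr0 addr0 | exists [::]]. Qed.

Let corner0 i j : corner (e i) (e j) setT 0.
Proof. by exists 0; rewrite // nmul0r nmul0l. Qed.

(** Uniqueness of the vector representing the zero functional. *)
Lemma corner_left_nondegenerate i j v : corner (e i) (e j) setT v ->
  (forall w, corner (e j) (e (nu i)) setT w -> B v w = 0) -> v = 0.
Proof.
move=> Vv v0; have [_ _ _ /(_ _ (@dual0 _))[u [_ uu]]] := nondeg i j.
rewrite -(uu v) // (uu 0) //; split=> // w _; exact: (lin0 (linl _)).
Qed.

Lemma corner_right_nondegenerate i j w : corner (e j) (e (nu i)) setT w ->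
  (forall v, corner (e i) (e j) setT v -> B v w = 0) -> w = 0.
Proof.
move=> Ww w0; have [_ _ /(_ _ (@dual0 _))[u [_ uu]] _] := nondeg i j.
rewrite -(uu w) // (uu 0) //; split=> // v _; exact: (lin0 (linr _)).
Qed.

(** The form restricted to a Peirce component of [a] is read off the form at
    [a] itself, by associativity and the orthogonality given by [nu]. *)
Lemma form_left_nondegenerate a : (forall x, B a x = 0) -> a = 0.
Proof.
move=> a0; apply: (peirce_eq0 De) => i j.
apply: (corner_left_nondegenerate (cornerT _ _ _)) => _ [x _ <-].
rewrite -form_corner -nmulA.
rewrite (@form_eqr i _ x (x ** e (nu i))); last by rewrite -nmulA idem.
rewrite nmulA formA nmulA.
by rewrite (@form_eql i _ (e i ** a) a) ?a0 // nmulA idem.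
Qed.

Lemma form_right_nondegenerate b : (forall x, B x b = 0) -> b = 0.
Proof.
move=> b0; apply: (peirce_eq0 De) => j l; have [mu _ muK] := nu_bij.
rewrite -(muK l); set i := mu l.
apply: (corner_right_nondegenerate (cornerT _ _ _)) => _ [x _ <-].
by rewrite -form_corner.
Qed.

(** It is enough to test the equation on [e_j A e_(nu i)], the only Peirce
    component that contributes to either side. *)
Let form_swap i j a b : corner (e i) (e j) setT a ->
  corner (e (nu i)) (e (nu j)) setT b ->
  (forall w, corner (e j) (e (nu i)) setT w -> B a w = B w b) ->
  forall x, B a x = B x b.
Proof.
move=> [a' _ <-] [b' _ <-] ab x; rewrite form_corner ab //.
rewrite formA !nmulA idem; apply: form_eql; by rewrite nmulA idem.
Qed.

(** For [a] in [e_i A e_j] the functional [(a, -)] lives on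
    [e_j A e_(nu i)], where it is represented by an element of
    [e_(nu i) A e_(nu j)] by nondegeneracy of the next pairing. *)
Lemma nakayama_right_partner a : exists b, forall x, B a x = B x b.
Proof.
apply: (peirce_ind De (P := fun a => exists b, forall x, B a x = B x b)).
- by exists 0 => x; rewrite (lin0 (linl _)) (lin0 (linr _)).
- move=> a1 a2 [b1 ab1] [b2 ab2]; exists (b1 + b2) => x.
  by rewrite [LHS](linD _ _ (linl _)) [RHS](linD _ _ (linr _)) ab1 ab2.
move=> i j; have [_ + _ _] := nondeg i j => /(_ _ (cornerT i j a)) dual_a.
have [_ _ /(_ _ dual_a)[b [[Wb ab] _]] _] := nondeg j (nu i).
by exists b; apply: form_swap (cornerT i j a) Wb _ => w /ab.
Qed.

Lemma nakayama_left_partner b : exists a, forall x, B a x = B x b.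
Proof.
apply: (peirce_ind De (P := fun b => exists a, forall x, B a x = B x b)).
- by exists 0 => x; rewrite (lin0 (linl _)) (lin0 (linr _)).
- move=> b1 b2 [a1 ab1] [a2 ab2]; exists (a1 + a2) => x.
  by rewrite [LHS](linD _ _ (linl _)) [RHS](linD _ _ (linr _)) ab1 ab2.
move=> k l; have [mu _ muK] := nu_bij.
rewrite -(muK k) -(muK l); set i := mu k; set j := mu l.
have [+ _ _ _] := nondeg j (nu i) => /(_ _ (cornerT (nu i) (nu j) b)) dual_b.
have [_ _ _ /(_ _ dual_b)[a [[Va ab] _]]] := nondeg i j.
by exists a; apply: form_swap Va (cornerT _ _ b) _ => w /ab.
Qed.

(** Partners are unique by nondegeneracy, so that linearity,
    multiplicativity and bijectivity all follow from that uniqueness. *)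
Lemma exists_nakayama_automorphism : exists2 eta : A -> A,
  nakayama_automorphism B eta
  & forall eta', nakayama_automorphism B eta' -> eta' = eta.
Proof.
have /choice[eta etaE] := nakayama_right_partner.
have etaP a b : (forall x, B a x = B x b) -> eta a = b.
  move=> ab; apply/eqP; rewrite -subr_eq0; apply/eqP.
  apply: form_right_nondegenerate => x.
  by rewrite [LHS](linB _ _ (linr _)) -etaE -ab subrr.
exists eta; last first.
  move=> eta' [_ eta'E]; apply/esym/funext => a; apply: etaP => x.
  exact: eta'E.
split=> //; split.
- move=> k x y; apply: etaP => z.
  by case: data => -[-> ->] _ _ _ _; rewrite (etaE x) (etaE y).
- move=> x y; apply: etaP => z.
  by rewrite formA (etaE x) formA (etaE y) formA.
apply: bijective_of_inj_surj => [x y xy|b].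
  apply/eqP; rewrite -subr_eq0; apply/eqP.
  apply: form_left_nondegenerate => z.
  by rewrite [LHS](linB _ _ (linl _)) (etaE x) (etaE y) xy subrr.
by have [a ab] := nakayama_left_partner b; exists a; apply: etaP.
Qed.

Let form_peirce x y :
  (forall i j, B (e i ** x ** e j) (e j ** y ** e (nu i)) = 0) -> B x y = 0.
Proof.
move=> xy0; have [s _ {1}->] := left_peirce_sum De x.
rewrite [LHS](lin_sum _ _ _ (linl _)) big1 // => i _.
have [t _ ->] := right_peirce_sum De (e i ** x).
rewrite [LHS](lin_sum _ _ _ (linl _)) big1 // => j _.
by rewrite form_corner.
Qed.

Let form_degree i j : form_of_degree gr B
  (corner (e i) (e j) setT) (corner (e j) (e (nu i)) setT) (d i).
Proof. by case: data => _ _ _ _ /(_ i j)[]. Qed.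

Lemma constant_degree_form d0 p q x y : (forall i, d i = d0) ->
  gr p x -> gr q y -> p + q <> d0 -> B x y = 0.
Proof.
move=> dd px qy pq; apply: form_peirce => i j; apply/eqP.
apply: contra_notT pq => B0; rewrite -(dd i).
apply: (form_degree (i := i) (j := j)).
exists (e i ** x ** e j), (e j ** y ** e (nu i)).
by split=> //; split=> //; apply: (degree_peirce grG De).
Qed.

(** For [k != h] the component of degree [k] of [eta a] pairs to zero with
    everything: against [x] of degree [d0 - k] it gives
    [(x, eta a) = (a, x)], which vanishes as [h + (d0 - k) != d0]. *)
Lemma constant_degree_nakayama_graded d0 eta : (forall i, d i = d0) ->
  nakayama_automorphism B eta -> forall h x, gr h x -> gr h (eta x).
Proof.
move=> dd [_ etaE] h a ha.
have compE k : k != h -> comp k (eta a) = 0.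
  move=> kh; apply: form_right_nondegenerate.
  apply: (grading_ind grG) => [|x y xb yb|p x px].
  - exact: (lin0 (linl _)).
  - by rewrite [LHS](linD _ _ (linl _)) xb yb addr0.
  have [pk|/eqP pk] := eqVneq (p + k) d0; last first.
    exact: (constant_degree_form dd px (mem_component dgr k _) pk).
  have : B x (eta a) = 0.
    rewrite -etaE; apply: (constant_degree_form dd ha px) => hp.
    by move: kh; rewrite -(inj_eq (addrI p)) pk addrC hp eqxx.
  have [s [us ks sE]] := component_sum_at dgr k (eta a).
  rewrite {1}sE (lin_sum _ _ _ (linr x)) (bigD1_seq k) //= big1 ?addr0 // => l lk.
  apply: (constant_degree_form dd px (mem_component dgr l _)).
  by rewrite -pk => /addrI/eqP; rewrite (negPf lk).
have [s us ->] := component_sum dgr (eta a).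
apply: subspace_sum => [|k _ _]; first exact: grading_subspace.
have [->|/compE->] := eqVneq k h; first exact: mem_component.
by apply: subspace0; apply: grading_subspace.
Qed.

Definition nonzero_corner i j (h : int) : Prop :=
  exists x, gr h x /\ e i ** x ** e j <> 0.

Let corner_component k i j x : corner (e i) (e j) setT x ->
  gr k (comp k x) /\ e i ** comp k x ** e j = comp k x.
Proof.
move=> /(family_cornerP De)[ix xj]; split; first exact: mem_component.
have [ei ej] := (family_degree0 De i, family_degree0 De j).
by rewrite -(component_mull grG) // -(component_mulr grG) // ix xj.
Qed.

(** The form pairs [e_i A_h e_j] perfectly with [e_j A_(d i - h) e_(nu i)]. *)
Lemma nonzero_corner_dual i j h :
  nonzero_corner i j h -> nonzero_corner j (nu i) (d i - h).
Proof.
move=> [x [hx x0]]; set v := e i ** x ** e j in x0.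
have [w Ww vw] : exists2 w, corner (e j) (e (nu i)) setT w & B v w <> 0.
  apply: contrapT => nw; apply: x0.
  apply: (corner_left_nondegenerate (cornerT _ _ _)) => w Ww.
  by apply: contrapT => vw; apply: nw; exists w.
have [k vk] : exists k, B v (comp k w) <> 0.
  apply: contrapT => nk; apply: vw; have [s _ ->] := component_sum dgr w.
  rewrite [LHS](lin_sum _ _ _ (linr v)) big1 // => k _.
  by apply: contrapT => vk; apply: nk; exists k.
have [kw wE] := corner_component k Ww.
have hk : h + k = d i.
  apply: (form_degree (i := i) (j := j)); exists v, (comp k w); split.
  - by split; [exact: cornerT | exact: (degree_peirce grG De)].
  - by split=> //; exists (comp k w).
  - exact/eqP.
exists (comp k w); rewrite -hk addrC addKr; split=> // w0.
by apply: vk; rewrite -wE w0; apply: (lin0 (linr v)).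
Qed.

Lemma nonzero_corner_predual i j h :
  nonzero_corner j (nu i) h -> nonzero_corner i j (d i - h).
Proof.
move=> [x [hx x0]]; set w := e j ** x ** e (nu i) in x0.
have [v Vv vw] : exists2 v, corner (e i) (e j) setT v & B v w <> 0.
  apply: contrapT => nv; apply: x0.
  apply: (corner_right_nondegenerate (cornerT _ _ _)) => v Vv.
  by apply: contrapT => vw; apply: nv; exists v.
have [k kw] : exists k, B (comp k v) w <> 0.
  apply: contrapT => nk; apply: vw; have [s _ ->] := component_sum dgr v.
  rewrite [LHS](lin_sum _ _ _ (linl w)) big1 // => k _.
  by apply: contrapT => vk; apply: nk; exists k.
have [kv vE] := corner_component k Vv.
have hk : k + h = d i.
  apply: (form_degree (i := i) (j := j)); exists (comp k v), w; split.
  - by split=> //; exists (comp k v).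
  - by split; [exact: cornerT | exact: (degree_peirce grG De)].
  - exact/eqP.
exists (comp k v); rewrite -hk addrK; split=> // v0.
by apply: kw; rewrite -vE v0; apply: (lin0 (linl w)).
Qed.

(** Apply the duality to the pair [(i, j)], then to the pair [(j, nu i)]. *)
Lemma nonzero_corner_nu i j h : nonzero_corner i j h <->
  nonzero_corner (nu i) (nu j) (d j - d i + h).
Proof.
split=> [/nonzero_corner_dual/nonzero_corner_dual|].
  by congr (nonzero_corner _ _ _); lia.
move/nonzero_corner_predual/nonzero_corner_predual.
by congr (nonzero_corner _ _ _); lia.
Qed.

Section ConstantDegree.
Hypothesis pos : forall h : int, h < 0 -> gr h = [set 0].
Hypothesis e0 : forall i x, gr 0 x ->
  exists c, e i ** x = c *: e i /\ x ** e i = c *: e i.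
Hypothesis gen : forall n : nat,
  gr n.+1%:Z = iter n (product_space (gr 1)) (gr 1).

Let supports_ge0 i j h : nonzero_corner i j h -> 0 <= h.
Proof.
move=> [x [hx x0]]; rewrite leNgt; apply/negP => h0; apply: x0.
by move: hx; rewrite pos // => ->; rewrite nmul0r nmul0l.
Qed.

Let supports0 i j : nonzero_corner i j 0 -> i = j.
Proof.
move=> [x [x0 xij]]; apply: contrapT => /eqP ij; apply: xij.
have [c [-> _]] := e0 i x0.
by rewrite -nscaleAl (family_mul De) (negPf ij) scaler0.
Qed.

(** Some monomial in [A_1 A_(n+1)] survives between [e i] and [e j], and so
    does one of its middle Peirce components. *)
Let supports_split i j n : nonzero_corner i j n.+2%:Z ->
  exists k, nonzero_corner i k 1 /\ nonzero_corner k j n.+1%:Z.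
Proof.
move=> [x [+ x0]]; rewrite gen iterS -gen => -[s Ss xs].
apply: contrapT => nk; apply: x0; rewrite xs nmul_sumr nmul_suml big_seq big1 //.
move=> _ /Ss[y [z [y1 zn ->]]]; have [t [_ tz _]] := local_unit De z.
rewrite -tz nmul_suml !nmul_sumr nmul_suml big1 // => k _.
have [yk|/eqP yk] := eqVneq (e i ** y ** e k) 0.
  by rewrite -[e k](idem k) !nmulA yk !nmul0l.
have [zk|/eqP zk] := eqVneq (e k ** z ** e j) 0.
  by rewrite !nmulA -(nmulA (e i ** y)) -!nmulA (nmulA (e k)) zk !nmul0r.
by case: nk; exists k; split; [exists y|exists z].
Qed.

(** The partner of [e_i A_1 e_j] lives in degree [d j - d i + 1 >= 0]; were
    this degree zero, then [nu i = nu j], that is [i = j], and the degree would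
    be one. *)
Let arrow_le i j : nonzero_corner i j 1 -> d i <= d j.
Proof.
move=> ij; have := (nonzero_corner_nu _ _ _).1 ij => nuij.
have := supports_ge0 nuij; rewrite le_eqVlt => /orP[/eqP dij|]; last by lia.
move: nuij; rewrite -dij => /supports0/(bij_inj nu_bij) E.
by rewrite E.
Qed.

Let nu_arrow_le i j : nonzero_corner (nu i) (nu j) 1 -> d j <= d i.
Proof.
move=> nuij; have E : 1 = d j - d i + (d i - d j + 1) by lia.
rewrite E in nuij; have ij := (nonzero_corner_nu _ _ _).2 nuij.
have := supports_ge0 ij; rewrite le_eqVlt => /orP[/eqP dij|]; last by lia.
by move: ij; rewrite -dij => /supports0 ->.
Qed.

Let path_le n i j : nonzero_corner i j n.+1%:Z -> d i <= d j.
Proof.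
elim: n i => [|n IHn] i; first exact: arrow_le.
by move=> /supports_split[k [/arrow_le ik /IHn]]; apply: le_trans.
Qed.

Let nu_path_le n i j : nonzero_corner (nu i) (nu j) n.+1%:Z -> d j <= d i.
Proof.
have [mu _ muK] := nu_bij.
elim: n i => [|n IHn] i; first exact: nu_arrow_le.
move=> /supports_split[k]; rewrite -(muK k) => -[/nu_arrow_le ik /IHn kj].
exact: le_trans kj ik.
Qed.

Let supports_eq i j h : nonzero_corner i j h -> d i = d j.
Proof.
move=> ij; have := supports_ge0 ij; case: h ij => [[|n]|//] ij _.
  by rewrite (supports0 ij).
have le1 := path_le ij; apply/eqP; rewrite eq_le le1 /=.
have := (nonzero_corner_nu _ _ _).1 ij.
have -> : d j - d i + n.+1 = (absz (d j - d i) + n).+1%:Z by lia.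
exact: nu_path_le.
Qed.

(** The degree map agrees at linked vertices, hence along every chain. *)
Lemma connected_constant_degree : connected_family e ->
  forall i j, d i = d j.
Proof.
move=> conn i j; have [s + <-] := conn i j.
have corner_supp k l : corner (e k) (e l) setT <> [set 0] -> d k = d l.
  move=> kl; apply: contrapT => dkl; apply: kl; apply/seteqP; split; last first.
    by move=> _ ->.
  move=> x Vx /=; have [s' _ ->] := component_sum dgr x.
  rewrite big1 // => h _; apply: contrapT => xh; apply: dkl.
  have [hx xE] := corner_component h Vx.
  by apply: (supports_eq (h := h)); exists (comp h x); rewrite xE.
elim: s i {j} => //= k s IHs i /andP[/asboolP ik /IHs <-].
by case: ik => /corner_supp.
Qed.

End ConstantDegree.
End NakayamaForms.

Section ChangeOfFamily.
Context {K : fieldType} {A : nualgType K} (gr : int -> set A).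
Context {I : choiceType} (e : I -> A).
Hypothesis grG : is_grading gr.
Hypothesis De : distinguished_family gr e.
Hypothesis e0 : forall i x, gr 0 x ->
  exists c, e i ** x = c *: e i /\ x ** e i = c *: e i.

Let gr0M x y : gr 0 x -> gr 0 y -> gr 0 (x ** y).
Proof. by move=> x0 y0; rewrite -[0]addr0; case: grG => _; apply. Qed.

(** For a local corner [uA_0u], two different members of the family below [u]
    would give two different maximal left ideals of codimension one. *)
Lemma local_idempotent_family u : gr 0 u -> u ** u = u -> u <> 0 ->
  local_algebra (corner u u (gr 0)) -> exists k, u = e k.
Proof.
move=> gu uu u0 [M [_ maxM]]; apply: (degree0_primitive De e0) => // k l ku lu.
have [eps [epsl epsE _ _]] := exists_vertex_coordinates grG De e0.
have epsM i x y : gr 0 x -> gr 0 y -> eps i (x ** y) = eps i x * eps i y.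
  move=> x0 y0; apply: (family_scale_inj De (i := i)).
  rewrite -epsE; last exact: gr0M.
  by rewrite nmulA epsE // -nscaleAl epsE // scalerA.
have sg := grading_subspace grG 0.
set S := corner u u (gr 0) in maxM.
have S0 x : S x -> gr 0 x by move=> [y y0 <-]; apply: gr0M => //; apply: gr0M.
have sS : subspace S.
  split=> [|c _ _ [x x0 <-] [y y0 <-]].
    by exists 0; [apply: subspace0 | rewrite nmul0r nmul0l].
  exists (c *: x + y); first by apply: subspaceD => //; apply: subspaceZ.
  by rewrite nmulDr nmulDl -nscaleAr -nscaleAl.
have SM x y : S x -> S y -> S (x ** y).
  move=> Sx Sy; exists (x ** y); first by apply: gr0M; apply: S0.
  have [ux _] := cornerP uu uu Sx; have [_ yu] := cornerP uu uu Sy.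
  by rewrite nmulA ux -nmulA yu.
have epsu i : e i ** u <> 0 -> eps i u != 0.
  by move=> iu; apply/eqP => eu; rewrite epsE // eu scale0r in iu.
have maxeps i : e i ** u <> 0 -> maximal_left_ideal S [set x | S x /\ eps i x = 0].
  move=> iu; split.
  - split=> [x []//||s x Ss [Sx ix]]; last first.
      split; [exact: SM | rewrite epsM ?ix ?mulr0 //; exact: S0].
    split=> [|c x y [Sx ix] [Sy iy]].
      by split; [apply: subspace0 | apply: (lin0 (epsl i))].
    split; first by apply: subspaceD => //; apply: subspaceZ.
    by rewrite [LHS](epsl i) ix iy scaler0 addr0.
  - move=> MS; have : S u by exists u; rewrite ?uu.
    by rewrite -MS => -[_ /eqP]; rewrite (negPf (epsu _ iu)).
  move=> L [LS sL LM] sub.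
  have [LM'|] := pselect (L `<=` [set x | S x /\ eps i x = 0]).
    by left; apply/seteqP.
  move=> nsub; right; apply/seteqP; split=> // x Sx.
  have [y Ly iy] : exists2 y, L y & eps i y != 0.
    apply: contrapT => ny; apply: nsub => y Ly; split; first exact: LS.
    by apply/eqP; apply: contrapT => /negP iy; apply: ny; exists y.
  rewrite -[x](subrK ((eps i x / eps i y) *: y)).
  apply: subspaceD => //; last exact: subspaceZ.
  have Sy : S y by apply: LS.
  apply: sub; split; first by apply: subspaceB => //; apply: subspaceZ.
  rewrite [LHS](linB _ _ (epsl i)) [X in _ - X](linZ _ _ (epsl i)).
  by rewrite [_ *: _]mulfVK ?subrr.
(* Both ideals are the unique maximal one, but [u ** e l ** u] separates
   them when [k != l]. *)
have /maxM kM := maxeps k ku; have /maxM lM := maxeps l lu.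
apply: contrapT => /eqP kl.
have el : gr 0 (e l) by apply: (family_degree0 De).
have epskl : eps k (e l) = 0.
  apply: (family_scale_inj De (i := k)).
  by rewrite /= -epsE // (family_mul De) (negPf kl) scale0r.
have epsll : eps l (e l) = 1.
  apply: (family_scale_inj De (i := l)).
  by rewrite /= -epsE // (family_idem De) scale1r.
have : [set x | S x /\ eps k x = 0] (u ** e l ** u).
  split; first by exists (e l).
  by rewrite epsM ?epsM ?epskl ?mulr0 ?mul0r //; apply: gr0M.
rewrite kM -lM => -[_]; rewrite epsM ?epsM ?epsll ?mulr1 //; last exact: gr0M.
by move/eqP; rewrite mulf_eq0 (negPf (epsu _ lu)).
Qed.

Variables (I' : choiceType) (e' : I' -> A).
Hypothesis Wb' : weakly_basic_family gr e'.

Lemma weakly_basic_family_bijection :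
  exists2 sigma : I' -> I, bijective sigma & forall i, e' i = e (sigma i).
Proof.
have [De' _ loc _] := Wb'.
have /choice[sigma sE] : forall i, exists k, e' i = e k.
  move=> i; apply: local_idempotent_family (loc i).
  - exact: (family_degree0 De').
  - exact: (family_idem De').
  - exact: (family_neq0 De').
exists sigma => //; apply: bijective_of_inj_surj => [i j ij|k].
  by apply: (family_inj De'); rewrite !sE ij.
apply: contrapT => nk; apply: (family_neq0 De (i := k)).
apply: (right_peirce_eq0 De') => i; rewrite sE (family_mul De).
by case: eqVneq => // ki; case: nk; exists i.
Qed.

(** Conjugate [nu] and reindex [d] by the bijection of families. *)
Lemma graded_nakayama_form_transfer B :
  graded_nakayama_form gr e' B -> graded_nakayama_form gr e B.
Proof.
have [sigma [tau sK tK] sE] := weakly_basic_family_bijection.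
have tE i : e i = e' (tau i) by rewrite sE tK.
move=> [nu [d [lB BA nu_bij Bnu Bdeg]]].
exists (fun i => sigma (nu (tau i))), (fun i => d (tau i)); split=> //.
- apply: bij_comp; first by exists tau.
  by apply: bij_comp => //; exists sigma.
- move=> i j; rewrite !tE; split=> [/Bnu <-|->]; first by rewrite tK.
  by apply/Bnu; rewrite sK.
by move=> i j; rewrite !tE sK.
Qed.

End ChangeOfFamily.

(** * Quivers and Nakayama forms of split basic graded algebras *)

Theorem corollary3p8 (K : fieldType) (A : nualgType K) (gr : int -> set A)
    (I : choiceType) (e : I -> A) :
  is_grading gr ->
  (forall h : int, h < 0 -> gr h = [set 0]) ->
  basic_family gr e ->
  split_family gr e ->
  semisimple_algebra (gr 0) ->
  (exists Q : gquiver, presented_by gr Q /\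
     forall Q' : gquiver, presented_by gr Q' -> gquiver_iso Q Q') /\
  (connected_family e ->
   (forall n : nat, gr n.+1%:Z = iter n (product_space (gr 1)) (gr 1)) ->
   ((graded_pseudo_Frobenius gr <->
     exists B : A -> A -> K, nakayama_form_of_constant_degree gr e B) /\
    (forall B : A -> A -> K, graded_nakayama_form gr e B ->
     exists eta : A -> A,
       [/\ nakayama_automorphism B eta,
           forall eta', nakayama_automorphism B eta' -> eta' = eta
         & forall h x, gr h x -> gr h (eta x)]))).
Proof.
move=> grG pos [Wb _] Sp ss; have [De lfd _ _] := Wb.
have e0 := degree0_mull grG De pos ss Wb Sp.
split=> [|conn gen].
  have /choice[dbc bc] : forall x : I * I * nat,
      exists t : nat * (nat -> A) * (nat -> A -> K),
      arrow_coordinates gr e x.1.1 x.1.2 x.2.+1%:Z t.1.1 t.1.2 t.2.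
    move=> [[i j] m].
    have [n [b [c nbc]]] := exists_arrow_coordinates grG De lfd i j m.+1%:Z.
    by exists (n, b, c).
  pose dim x := (dbc x).1.1; exists (canonical_quiver dim); split.
    exact: (canonical_presented_by grG pos De e0 bc).
  by move=> Q' pQ'; apply: (presented_by_canonical grG De e0 bc pQ').
(* If [I] is empty then every constant will do. *)
have constant B nu d : nakayama_form_data gr e B nu d ->
    exists d0, forall i, d i = d0.
  move=> dB; have dd := connected_constant_degree grG De dB pos e0 gen conn.
  have [[i0 _]|noI] := pselect (exists i : I, True); first by exists (d i0).
  by exists 0 => i; case: noI; exists i.
split; first split.
- move=> [I' [e' [Wb' [B /(graded_nakayama_form_transfer grG De e0 Wb')]]]].
  move=> [nu [d dB]]; exists B, nu, d; split=> //; exact: constant dB.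
- move=> [B [nu [d [dB _]]]]; exists I, e; split=> //.
  by exists B, nu, d.
move=> B [nu [d dB]]; have [d0 dd] := constant _ _ _ dB.
have [eta etaP eta_uniq] := exists_nakayama_automorphism De dB.
exists eta; split=> //.
exact: (constant_degree_nakayama_graded grG De dB dd etaP).
Qed.
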